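(* Let $\kappa_a,\kappa_b\in\mathbb{R}$. The first blow-up time $\bar t(\kappa_a,\kappa_b)$ of the function $s_{\kappa_a,\kappa_b}$ defined in the context is bounded by $$\bar t(\kappa_a,\kappa_b)\le \frac{2\pi}{\mathrm{Re}(\sqrt{x+y}-\sqrt{x-y})},\qquad x=\frac{\kappa_b}{2},\quad y=\frac{\sqrt{\kappa_b^2+4\kappa_a}}{2},$$ where the right-hand side is $+\infty$ if the denominator is zero. The equality holds if and only if $\kappa_a=0$, and in this case $\bar t(0,\kappa_b)=2\pi/\sqrt{\kappa_b}$. In particular, $\bar t(\kappa_a,\kappa_b)$ is finite if and only if either ($\kappa_b\ge 0$ and $\kappa_b^2+4\kappa_a>0$) or ($\kappa_b<0$ and $\kappa_a>0$).
   Context: $\sqrt{\cdot}$ is the principal value of the complex square root, and $\mathrm{sinc}(z)=\sin(z)/z$ (an entire function, $\mathrm{sinc}(0)=1$). With $x=\frac{\kappa_b}{2}$, $y=\frac{\sqrt{4\kappa_a+\kappa_b^2}}{2}$ and $\theta_\pm=\frac12(\sqrt{x+y}\pm\sqrt{x-y})$, define for $t>0$ $$s_{\kappa_a,\kappa_b}(t):=\frac{2}{t}\left(\frac{\mathrm{sinc}(2\theta_-t)-\mathrm{sinc}(2\theta_+t)}{\mathrm{sinc}(\theta_-t)^2-\mathrm{sinc}(\theta_+t)^2}\right),$$ where, for values of the parameters for which the denominator is zero (i.e. $\theta_+=\pm\theta_-$), the function is understood in the limit. Its maximal connected interval of definition starting at $0$ is $(0,\bar t(\kappa_a,\kappa_b))$,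 and $\bar t(\kappa_a,\kappa_b)\in(0,+\infty]$ is called the first blow-up time.
   Formalization: ''Equality iff κ_a=0'' is false (κ_a=-9, κ_b=10 gives s=4cot t, blow-up π = bound; also ∞=∞ cases). Proved instead: for a finite bound, equality iff κ_a=0 or θ₊=nθ₋ for an integer n≥2; equality always holds if κ_a=0. For κ_b≤0, 2π/√κ_b is read as +∞. *)

(* Defs.v *)
(* Stdlib reals with Coquelicot (complex numbers, filters, Rbar). *)
From Stdlib Require Import Reals Lra.
From Coquelicot Require Import Coquelicot.
Open Scope R_scope.

(* Principal square root: nonnegative real part, and nonnegative imaginary part
   on the branch cut, so that Csqrt (-1) = Ci. *)
Definition Csqrt (z : C) : C :=
  (sqrt ((Cmod z + Re z) / 2),
   (if Rle_dec 0 (Im z) then 1 else -1) * sqrt ((Cmod z - Re z) / 2)).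

Lemma Csqrt_sqr (z : C) : (Csqrt z * Csqrt z)%C = z.
Proof.
  destruct z as [a b].
  assert (Hm : 0 <= a ^ 2 + b ^ 2) by nra.
  assert (Hs : Cmod (a, b) * Cmod (a, b) = a ^ 2 + b ^ 2)
    by (unfold Cmod; simpl; apply sqrt_sqrt; simpl in Hm; lra).
  assert (Hp : 0 <= Cmod (a, b)) by apply Cmod_ge_0.
  unfold Csqrt; simpl Re; simpl Im.
  set (m := Cmod (a, b)) in *.
  assert (H1 : 0 <= (m + a) / 2) by nra.
  assert (H2 : 0 <= (m - a) / 2) by nra.
  assert (E1 := sqrt_sqrt _ H1); assert (E2 := sqrt_sqrt _ H2).
  assert (E3 : sqrt ((m + a) / 2) * sqrt ((m - a) / 2) = Rabs b / 2).
  { rewrite <- sqrt_mult by assumption.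
    replace ((m + a) / 2 * ((m - a) / 2)) with (Rsqr (b / 2))
      by (unfold Rsqr; nra).
    rewrite sqrt_Rsqr_abs; unfold Rdiv.
    rewrite Rabs_mult, (Rabs_pos_eq (/ 2)); lra. }
  unfold Cmult; simpl.
  destruct (Rle_dec 0 b) as [Hb | Hb].
  - rewrite (Rabs_pos_eq b Hb) in E3. f_equal; nra.
  - rewrite (Rabs_left b) in E3 by lra. f_equal; nra.
Qed.

Lemma Csqrt_Re_ge0 (z : C) : 0 <= Re (Csqrt z).
Proof. apply sqrt_pos. Qed.

Lemma Csqrt_Im_ge0 (z : C) : Re (Csqrt z) = 0 -> 0 <= Im (Csqrt z).
Proof.
  intros H; assert (Hz := f_equal Im (Csqrt_sqr z)).
  rewrite im_mult, H in Hz.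
  unfold Csqrt in *; simpl in *.
  destruct (Rle_dec 0 (Im z)) as [Hb | Hb]; [| exfalso; simpl in Hb; lra].
  rewrite Rmult_1_l; apply sqrt_pos.
Qed.

(* sin (a + i b) = sin a cosh b + i cos a sinh b *)
Definition Csin (z : C) : C :=
  (sin (Re z) * cosh (Im z), cos (Re z) * sinh (Im z)).

Definition Csinc (z : C) : C :=
  if Ceq_dec z 0 then RtoC 1 else (Csin z / z)%C.

Definition par_x (kb : R) : C := RtoC (kb / 2).

Definition par_y (ka kb : R) : C := (Csqrt (RtoC (4 * ka + kb ^ 2)) / 2)%C.

Definition theta_plus (ka kb : R) : C :=
  ((Csqrt (par_x kb + par_y ka kb) + Csqrt (par_x kb - par_y ka kb)) / 2)%C.

Definition theta_minus (ka kb : R) : C :=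
  ((Csqrt (par_x kb + par_y ka kb) - Csqrt (par_x kb - par_y ka kb)) / 2)%C.

Definition s_num (ka kb t : R) : C :=
  (Csinc (2 * theta_minus ka kb * t) - Csinc (2 * theta_plus ka kb * t))%C.

Definition s_den (ka kb t : R) : C :=
  (Csinc (theta_minus ka kb * t) ^ 2 - Csinc (theta_plus ka kb * t) ^ 2)%C.

Definition s_formula (ka kb t : R) : C :=
  (2 / t * (s_num ka kb t / s_den ka kb t))%C.

(* Parameters for which the denominator vanishes for every t. *)
Definition degenerate (ka kb : R) : Prop :=
  theta_plus ka kb = theta_minus ka kb \/
  theta_plus ka kb = (- theta_minus ka kb)%C.

(* [s_value ka kb t l]: s_{ka,kb} is defined at t, with value l.  For degenerate
   parameters l is the limit, at fixed t, of the formula as the parameters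
   (ka', kb') tend to (ka, kb) among those for which the formula makes sense;
   a pole is not a value. *)
Definition s_value (ka kb t : R) (l : C) : Prop :=
  (s_den ka kb t <> 0 /\ l = s_formula ka kb t) \/
  (degenerate ka kb /\
   filterlim (fun k : R * R => s_formula (fst k) (snd k) t)
     (within (fun k : R * R => s_den (fst k) (snd k) t <> 0)
        (locally (ka, kb)))
     (locally l)).

(* Right end point of the maximal interval (0, T) on which s_{ka,kb} is defined. *)
Definition blowup_time (ka kb : R) : Rbar :=
  Lub_Rbar (fun T : R =>
    0 <= T /\ forall t : R, 0 < t < T -> exists l : C, s_value ka kb t l).

Definition blowup_bound (ka kb : R) : Rbar :=
  let d := Re (Csqrt (par_x kb + par_y ka kb) - Csqrt (par_x kb - par_y ka kb))%C in
  if Req_EM_T d 0 then p_infty else Finite (2 * PI / d).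

(* Main.v *)
Require Import Defs.
From Stdlib Require Import Reals.
From Coquelicot Require Import Coquelicot.
From Stdlib Require Import ZArith Lra Lia Psatz.
Open Scope R_scope.

(** Write [a] and [b] for the principal roots of [x + y] and [x - y], so that
    [theta_plus + theta_minus = a], [theta_plus - theta_minus = b] and
    [(a b)^2 = - ka].  The parameters are degenerate exactly when [ka = 0];
    otherwise the blow-up time is the first positive zero of the denominator.

    If [ka > 0] the thetas are complex conjugates, and the denominator vanishes
    when [Re (sin z * conj z) = 0] for [z = theta_plus t]; this real part changes
    sign while [Re z] runs from [PI / 2] to [PI].  If [ka < 0] and the thetas are
    real, [0 < p < q], the denominator is positive at [t = PI / q] and nonpositive
    at [t = PI / p], so its zero is strictly earlier than [PI / p] unless
    [sin (q PI / p) = 0], that is [q = n p]; then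
    [|sin (n u)| < n sin u] on [(0, PI)] excludes earlier zeros.  In
    the other cases with [ka < 0] the thetas are real/imaginary or both imaginary,
    and monotonicity of [sinh y / y] shows that the denominator has no zero.

    If [ka = 0] the common factor [a b t^2] of numerator and denominator is
    cancelled explicitly, which gives the limit when [kb <> 0].  When [ka = kb = 0]
    the divided differences [(sinc u - sinc v) / (v^2 - u^2)] tend to [1 / 6], by
    the mean value inequality for [s sinc (u s) - s sinc (v s)].  At
    [t = 2 PI / sqrt kb] the formula is [2 / t * w cot w] with [w] close to [PI]
    along parameters with [theta_minus] fixed, so no limit exists. *)

(** * Limits of real and complex functions along a filter *)

Lemma filterlim_R_plus {T : Type} (F : (T -> Prop) -> Prop) {FF : Filter F}
  (f g : T -> R) (l m : R) :
  filterlim f F (locally l) -> filterlim g F (locally m) ->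
  filterlim (fun x => f x + g x) F (locally (l + m)).
Proof.
  intros Hf Hg.
  exact (filterlim_comp_2 f g Rplus Hf Hg (filterlim_plus l m)).
Qed.

Lemma filterlim_R_mult {T : Type} (F : (T -> Prop) -> Prop) {FF : Filter F}
  (f g : T -> R) (l m : R) :
  filterlim f F (locally l) -> filterlim g F (locally m) ->
  filterlim (fun x => f x * g x) F (locally (l * m)).
Proof.
  intros Hf Hg.
  exact (filterlim_comp_2 f g Rmult Hf Hg (filterlim_mult l m)).
Qed.

Lemma filterlim_R_opp {T : Type} (F : (T -> Prop) -> Prop) {FF : Filter F}
  (f : T -> R) (l : R) :
  filterlim f F (locally l) -> filterlim (fun x => - f x) F (locally (- l)).
Proof.
  intros Hf. exact (filterlim_comp _ _ _ f Ropp _ _ _ Hf (filterlim_opp l)).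
Qed.

Lemma filterlim_R_continuous {T : Type} (F : (T -> Prop) -> Prop) {FF : Filter F}
  (f : T -> R) (h : R -> R) (l : R) :
  continuity_pt h l -> filterlim f F (locally l) ->
  filterlim (fun x => h (f x)) F (locally (h l)).
Proof.
  intros Hh Hf. apply continuity_pt_filterlim in Hh.
  exact (filterlim_comp _ _ _ f h _ _ _ Hf Hh).
Qed.

(** Balls of [C] are products of two real balls, so complex limits reduce to limits of the two
    components. *)
Lemma filterlim_C {T : Type} (F : (T -> Prop) -> Prop) {FF : Filter F}
  (f : T -> C) (l : C) :
  filterlim f F (locally l) <->
  filterlim (fun x => Re (f x)) F (locally (Re l)) /\
  filterlim (fun x => Im (f x)) F (locally (Im l)).
Proof.
  split.
  - intros H; split; apply filterlim_locally; intros eps;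
      assert (H' := proj1 (filterlim_locally f l) H eps);
      revert H'; apply filter_imp; intros x [H1 H2]; assumption.
  - intros [H1 H2]. apply filterlim_locally; intros eps.
    generalize (filter_and _ _ (proj1 (filterlim_locally _ _) H1 eps)
      (proj1 (filterlim_locally _ _) H2 eps)).
    apply filter_imp; intros x [A B]; split; assumption.
Qed.

Lemma filterlim_C_plus {T : Type} (F : (T -> Prop) -> Prop) {FF : Filter F}
  (f g : T -> C) (l m : C) :
  filterlim f F (locally l) -> filterlim g F (locally m) ->
  filterlim (fun x => f x + g x)%C F (locally (l + m)%C).
Proof.
  rewrite !(filterlim_C F). intros [A B] [A' B']; split; apply (filterlim_R_plus F); assumption.
Qed.

Lemma filterlim_C_opp {T : Type} (F : (T -> Prop) -> Prop) {FF : Filter F}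
  (f : T -> C) (l : C) :
  filterlim f F (locally l) -> filterlim (fun x => - f x)%C F (locally (- l)%C).
Proof.
  rewrite !(filterlim_C F). intros [A B]; split; apply (filterlim_R_opp F); assumption.
Qed.

Lemma filterlim_C_minus {T : Type} (F : (T -> Prop) -> Prop) {FF : Filter F}
  (f g : T -> C) (l m : C) :
  filterlim f F (locally l) -> filterlim g F (locally m) ->
  filterlim (fun x => f x - g x)%C F (locally (l - m)%C).
Proof.
  intros. apply (filterlim_C_plus F); [assumption|]. now apply (filterlim_C_opp F).
Qed.

Lemma filterlim_C_mult {T : Type} (F : (T -> Prop) -> Prop) {FF : Filter F}
  (f g : T -> C) (l m : C) :
  filterlim f F (locally l) -> filterlim g F (locally m) ->
  filterlim (fun x => f x * g x)%C F (locally (l * m)%C).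
Proof.
  rewrite !(filterlim_C F). intros [A B] [A' B']; split.
  - apply (filterlim_R_plus F); [|apply (filterlim_R_opp F)]; now apply (filterlim_R_mult F).
  - apply (filterlim_R_plus F); now apply (filterlim_R_mult F).
Qed.

(** The inverse is the conjugate divided by Re^2 + Im^2, and this sum of squares is nonzero at
    [l]. *)
Lemma filterlim_C_inv {T : Type} (F : (T -> Prop) -> Prop) {FF : Filter F}
  (f : T -> C) (l : C) :
  l <> 0 -> filterlim f F (locally l) -> filterlim (fun x => / f x)%C F (locally (/ l)%C).
Proof.
  intros Hl. rewrite !(filterlim_C F). intros [A B].
  assert (N : filterlim (fun x => / (Re (f x) ^ 2 + Im (f x) ^ 2)) F
            (locally (/ (Re l ^ 2 + Im l ^ 2)))).
  { apply (filterlim_R_continuous F (fun x => Re (f x) ^ 2 + Im (f x) ^ 2) Rinv).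
    - apply continuity_pt_inv; [apply derivable_continuous_pt, derivable_pt_id|].
      intros H. apply Hl. destruct l as [p q]; simpl in H; unfold id in H.
      apply injective_projections; simpl; nra.
    - apply (filterlim_R_plus F); apply (filterlim_R_mult F); trivial;
        apply (filterlim_R_mult F); trivial; apply filterlim_const. }
  split.
  - apply (filterlim_R_mult F (fun x => Re (f x))
      (fun x => / (Re (f x) ^ 2 + Im (f x) ^ 2))); trivial.
  - apply (filterlim_R_mult F (fun x => - Im (f x))
      (fun x => / (Re (f x) ^ 2 + Im (f x) ^ 2))); trivial.
    now apply (filterlim_R_opp F).
Qed.

Lemma filterlim_C_div {T : Type} (F : (T -> Prop) -> Prop) {FF : Filter F}
  (f g : T -> C) (l m : C) :
  m <> 0 -> filterlim f F (locally l) -> filterlim g F (locally m) ->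
  filterlim (fun x => f x / g x)%C F (locally (l / m)%C).
Proof.
  intros. apply (filterlim_C_mult F); [assumption|]. now apply (filterlim_C_inv F).
Qed.

Lemma Cmod_le_Re_Im (z : C) : Cmod z <= Rabs (Re z) + Rabs (Im z).
Proof.
  destruct z as [p q].
  replace (p, q) with (RtoC p + Ci * RtoC q)%C
    by (apply injective_projections; simpl; ring).
  eapply Rle_trans; [apply Cmod_triangle|].
  rewrite Cmod_mult, Cmod_Ci, !Cmod_R. simpl.
  rewrite Rmult_1_l. apply Req_le. f_equal; f_equal; ring.
Qed.

(** Passes from the product balls of [C] to the modulus, in which the estimates on sinc are made. *)
Lemma filterlim_C_Cmod {T : Type} (F : (T -> Prop) -> Prop) {FF : Filter F}
  (f : T -> C) (l : C) :
  filterlim f F (locally l) <->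
  (forall eps : R, 0 < eps -> F (fun x => Cmod (f x - l)%C < eps)).
Proof.
  rewrite (filterlim_C F); split.
  - intros [A B] eps He.
    assert (He' : 0 < eps / 2) by lra.
    generalize (filter_and _ _ (proj1 (filterlim_locally _ _) A (mkposreal _ He'))
      (proj1 (filterlim_locally _ _) B (mkposreal _ He'))).
    apply filter_imp; intros x [H1 H2].
    change (Rabs (Re (f x) - Re l) < eps / 2) in H1.
    change (Rabs (Im (f x) - Im l) < eps / 2) in H2.
    eapply Rle_lt_trans; [apply Cmod_le_Re_Im|].
    change (Rabs (Re (f x) - Re l) + Rabs (Im (f x) - Im l) < eps). lra.
  - intros H; split; apply filterlim_locally; intros eps;
      generalize (H eps (cond_pos eps)); apply filter_imp; intros x Hx.
    + eapply Rle_lt_trans; [apply (re_le_Cmod (f x - l)%C)|exact Hx].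
    + eapply Rle_lt_trans; [|exact Hx].
      eapply Rle_trans; [|apply Rmax_Cmod]. apply Rmax_r.
Qed.

(** * Complex trigonometric identities *)

Definition Ccos (z : C) : C := (cos (Re z) * cosh (Im z), - (sin (Re z) * sinh (Im z))).

Lemma cosh_sqr x : cosh x * cosh x = 1 + sinh x * sinh x.
Proof.
  unfold cosh, sinh. assert (H := exp_plus x (- x)).
  replace (x + - x) with 0 in H by ring. rewrite exp_0 in H. nra.
Qed.

Lemma sinh_plus x y : sinh (x + y) = sinh x * cosh y + cosh x * sinh y.
Proof.
  unfold cosh, sinh. rewrite Ropp_plus_distr, !exp_plus. field.
Qed.

Lemma cosh_plus x y : cosh (x + y) = cosh x * cosh y + sinh x * sinh y.
Proof.
  unfold cosh, sinh. rewrite Ropp_plus_distr, !exp_plus. field.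
Qed.

Lemma sinh_neg x : sinh (- x) = - sinh x.
Proof. unfold sinh. rewrite Ropp_involutive. field. Qed.

Lemma cosh_neg x : cosh (- x) = cosh x.
Proof. unfold cosh. rewrite Ropp_involutive. field. Qed.

Lemma Csin_plus (z w : C) : (Csin (z + w) = Csin z * Ccos w + Ccos z * Csin w)%C.
Proof.
  unfold Csin, Ccos, Re, Im; apply injective_projections; simpl;
    rewrite ?sin_plus, ?cos_plus, ?sinh_plus, ?cosh_plus; ring.
Qed.

Lemma Ccos_plus (z w : C) : (Ccos (z + w) = Ccos z * Ccos w - Csin z * Csin w)%C.
Proof.
  unfold Csin, Ccos, Re, Im; apply injective_projections; simpl;
    rewrite ?sin_plus, ?cos_plus, ?sinh_plus, ?cosh_plus; ring.
Qed.

Lemma Csin_neg (z : C) : (Csin (- z) = - Csin z)%C.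
Proof.
  unfold Csin, Re, Im; apply injective_projections; simpl;
    rewrite ?sin_neg, ?cos_neg, ?cosh_neg, ?sinh_neg; ring.
Qed.

Lemma Ccos_neg (z : C) : (Ccos (- z) = Ccos z)%C.
Proof.
  unfold Ccos, Re, Im; apply injective_projections; simpl;
    rewrite ?sin_neg, ?cos_neg, ?cosh_neg, ?sinh_neg; ring.
Qed.

Lemma Csin_Ccos_sqr (z : C) : (Csin z * Csin z + Ccos z * Ccos z = 1)%C.
Proof.
  destruct z as [p q].
  assert (H := cosh_sqr q). assert (H2 := sin2_cos2 p). unfold Rsqr in H2.
  unfold Csin, Ccos, Re, Im; apply injective_projections; simpl; [|ring].
  transitivity (sin p * sin p * (cosh q * cosh q - sinh q * sinh q)
    + cos p * cos p * (cosh q * cosh q - sinh q * sinh q)); [ring|].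
  rewrite H. lra.
Qed.

Lemma Csin_0 : Csin 0 = 0.
Proof. unfold Csin; simpl. rewrite sin_0, cos_0, cosh_0, sinh_0. apply injective_projections; simpl; lra. Qed.

Lemma Ccos_0 : Ccos 0 = 1.
Proof. unfold Ccos; simpl. rewrite sin_0, cos_0, cosh_0, sinh_0. apply injective_projections; simpl; lra. Qed.

(** A multiplicative form that also covers z = 0, so that sin can be traded for sinc without a case
    distinction. *)
Lemma Csin_Csinc (z : C) : (Csin z = z * Csinc z)%C.
Proof.
  unfold Csinc. destruct (Ceq_dec z 0) as [->|H].
  - rewrite Csin_0; ring.
  - field; exact H.
Qed.

Lemma Csinc_0 : Csinc 0 = 1.
Proof. unfold Csinc. destruct (Ceq_dec 0 0); tauto. Qed.

Lemma Csinc_eq (z : C) : z <> 0 -> Csinc z = (Csin z / z)%C.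
Proof. intros H. unfold Csinc. destruct (Ceq_dec z 0); tauto. Qed.

Lemma Csinc_neg (z : C) : Csinc (- z) = Csinc z.
Proof.
  destruct (Ceq_dec z 0) as [->|H].
  - f_equal; ring.
  - rewrite !Csinc_eq; trivial.
    + rewrite Csin_neg. field; exact H.
    + intros E. apply H. replace z with (- - z)%C by ring. rewrite E. ring.
Qed.

(* With [A = v + u] and [B = v - u], the differences [sinc (2 u) - sinc (2 v)] and
   [sinc u ^ 2 - sinc v ^ 2] are [A B] times these two factors, up to powers of
   [u], [v] and [2]. *)
Definition den_factor (A B : C) : C :=
  (1 - Ccos A * Ccos B - (A * A + B * B) / 2 * (Csinc A * Csinc B))%C.
Definition num_factor (A B : C) : C := (Csinc A * Ccos B - Ccos A * Csinc B)%C.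

Lemma RtoC_2_neq_0 : RtoC 2 <> 0.
Proof. intros H. apply RtoC_inj in H. lra. Qed.

Lemma RtoC_2 : RtoC 2 = (1 + 1)%C.
Proof. rewrite <- RtoC_plus. f_equal; ring. Qed.

(** * Product formulas and factored differences of sinc *)

(** Product-to-sum formula: both sides are half of sin 2v + sin 2u. After the addition theorems each
    summand carries a factor sin^2 + cos^2 = 1 in the other variable; the next three identities work
    in the same way. *)
Lemma Csin_Ccos_prod (u v : C) :
  (Csin (v + u) * Ccos (v - u) = Csin v * Ccos v + Csin u * Ccos u)%C.
Proof.
  unfold Cminus. rewrite Csin_plus, Ccos_plus, Csin_neg, Ccos_neg.
  transitivity (Csin v * Ccos v * (Csin u * Csin u + Ccos u * Ccos u)
    + Csin u * Ccos u * (Csin v * Csin v + Ccos v * Ccos v))%C; [ring|].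
  rewrite !Csin_Ccos_sqr. ring.
Qed.

Lemma Ccos_Csin_prod (u v : C) :
  (Ccos (v + u) * Csin (v - u) = Csin v * Ccos v - Csin u * Ccos u)%C.
Proof.
  unfold Cminus. rewrite Csin_plus, Ccos_plus, Csin_neg, Ccos_neg.
  transitivity (Csin v * Ccos v * (Csin u * Csin u + Ccos u * Ccos u)
    - Csin u * Ccos u * (Csin v * Csin v + Ccos v * Ccos v))%C; [ring|].
  rewrite !Csin_Ccos_sqr. ring.
Qed.

Lemma Csin_Csin_prod (u v : C) :
  (Csin (v + u) * Csin (v - u) = Csin v * Csin v - Csin u * Csin u)%C.
Proof.
  unfold Cminus. rewrite !Csin_plus, Csin_neg, Ccos_neg.
  transitivity (Csin v * Csin v * (Csin u * Csin u + Ccos u * Ccos u)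
    - Csin u * Csin u * (Csin v * Csin v + Ccos v * Ccos v))%C; [ring|].
  rewrite !Csin_Ccos_sqr. ring.
Qed.

Lemma Ccos_Ccos_prod (u v : C) :
  (Ccos (v + u) * Ccos (v - u) = 1 - Csin v * Csin v - Csin u * Csin u)%C.
Proof.
  unfold Cminus. rewrite !Ccos_plus, Csin_neg, Ccos_neg.
  transitivity ((Csin v * Csin v + Ccos v * Ccos v) * (Csin u * Csin u + Ccos u * Ccos u)
    - Csin u * Csin u * (Csin v * Csin v + Ccos v * Ccos v)
    - Csin v * Csin v * (Csin u * Csin u + Ccos u * Ccos u))%C; [ring|].
  rewrite !Csin_Ccos_sqr. ring.
Qed.

(** With A = v + u and B = v - u, the numerator over 2uv is B sin A cos B - A cos A sin B. Writing
    sin z as z sinc z exposes the factor AB, the one that vanishes for degenerate parameters. *)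
Lemma Csinc_double_sub (u v : C) : u <> 0 -> v <> 0 ->
  (Csinc (2 * u) - Csinc (2 * v) =
   (v + u) * (v - u) * num_factor (v + u) (v - u) / (2 * u * v))%C.
Proof.
  intros Hu Hv.
  assert (H2 := RtoC_2_neq_0).
  rewrite !Csinc_eq by (apply Cmult_neq_0; trivial).
  transitivity (((v - u) * (Csin (v + u) * Ccos (v - u))
     - (v + u) * (Ccos (v + u) * Csin (v - u))) / (2 * u * v))%C.
  2: unfold num_factor; rewrite !Csin_Csinc; field; auto.
  rewrite Csin_Ccos_prod, Ccos_Csin_prod.
  rewrite RtoC_2 in *.
  replace ((1 + 1) * u)%C with (u + u)%C by ring.
  replace ((1 + 1) * v)%C with (v + v)%C by ring.
  assert (Hd : forall w : C, w <> 0 -> (w + w)%C <> 0).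
  { intros w Hw H. replace (w + w)%C with ((1 + 1) * w)%C in H by ring.
    now apply (Cmult_neq_0 _ _ H2 Hw). }
  rewrite !Csin_plus. field. auto.
Qed.

(** Here 1 - cos A cos B = sin^2 u + sin^2 v and sin A sin B = sin^2 v - sin^2 u. Weighted by AB =
    v^2 - u^2 and (A^2 + B^2)/2 = u^2 + v^2, their difference is 2 (v^2 sin^2 u - u^2 sin^2 v). *)
Lemma Csinc_sqr_sub (u v : C) : u <> 0 -> v <> 0 ->
  (Csinc u ^ 2 - Csinc v ^ 2 =
   (v + u) * (v - u) * den_factor (v + u) (v - u) / (2 * (u * u) * (v * v)))%C.
Proof.
  intros Hu Hv.
  assert (H2 := RtoC_2_neq_0).
  transitivity (((v + u) * (v - u) * (1 - Ccos (v + u) * Ccos (v - u))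
     - ((v + u) * (v + u) + (v - u) * (v - u)) / 2 * (Csin (v + u) * Csin (v - u)))
      / (2 * (u * u) * (v * v)))%C.
  2: unfold den_factor; rewrite !Csin_Csinc; field; auto.
  rewrite Ccos_Ccos_prod, Csin_Csin_prod.
  rewrite RtoC_2 in *.
  rewrite !Csinc_eq by trivial. simpl. field. auto.
Qed.

(** * Mean value inequality and continuity of sinc *)

(** Componentwise derivative of a complex function of a real variable, so that real mean value
    inequalities apply to each part. *)
Definition is_derive_C (f : R -> C) (s : R) (l : C) : Prop :=
  is_derive (fun x => Re (f x)) s (Re l) /\ is_derive (fun x => Im (f x)) s (Im l).

Lemma is_derive_C_minus (f g : R -> C) (s : R) (l m : C) :
  is_derive_C f s l -> is_derive_C g s m ->
  is_derive_C (fun x => f x - g x)%C s (l - m)%C.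
Proof.
  intros [A B] [A' B']; split.
  - exact (is_derive_minus _ _ _ _ _ A A').
  - exact (is_derive_minus _ _ _ _ _ B B').
Qed.

Lemma is_derive_C_scal (c : C) (f : R -> C) (s : R) (l : C) :
  is_derive_C f s l -> is_derive_C (fun x => c * f x)%C s (c * l)%C.
Proof.
  intros [A B]; split.
  - exact (is_derive_minus _ _ _ _ _ (is_derive_scal _ _ (fst c) _ A)
      (is_derive_scal _ _ (snd c) _ B)).
  - exact (is_derive_plus _ _ _ _ _ (is_derive_scal _ _ (fst c) _ B)
      (is_derive_scal _ _ (snd c) _ A)).
Qed.

Lemma is_derive_C_RtoC (f : R -> R) (s l : R) :
  is_derive f s l -> is_derive_C (fun x => RtoC (f x)) s (RtoC l).
Proof.
  intros H; split; [exact H|]. apply (is_derive_const (V := R_NormedModule) 0).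
Qed.

Lemma is_derive_C_Csin (z : C) (s : R) :
  is_derive_C (fun x => Csin (z * RtoC x)) s (z * Ccos (z * RtoC s))%C.
Proof.
  destruct z as [p q].
  assert (E : forall x : R, Cmult (p, q) (RtoC x) = (p * x, q * x))
    by (intros x; apply injective_projections; simpl; ring).
  rewrite E. split.
  - apply (is_derive_ext (fun x => sin (p * x) * cosh (q * x)));
      [intros x; now rewrite E|].
    unfold Ccos, cosh, sinh; simpl. auto_derive; trivial. field.
  - apply (is_derive_ext (fun x => cos (p * x) * sinh (q * x)));
      [intros x; now rewrite E|].
    unfold Ccos, cosh, sinh; simpl. auto_derive; trivial. field.
Qed.

(** The real inequality is applied to the real and imaginary parts separately, which costs the
    factor 2. *)
Lemma is_derive_C_bound (f g : R -> C) (M : R) :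
  (forall s, Rabs s <= 1 -> is_derive_C f s (g s) /\ Cmod (g s) <= M) ->
  Cmod (f 1 - f 0)%C <= 2 * M.
Proof.
  intros H.
  eapply Rle_trans; [apply Cmod_le_Re_Im|].
  assert (A : Rabs (Re (f 1) - Re (f 0)) <= M * Rabs (1 - 0)).
  { apply (bounded_variation (fun s => Re (f s)) (fun s => Re (g s))).
    intros t Ht. replace (1 - 0) with 1 in Ht by ring. rewrite Rabs_R1, Rminus_0_r in Ht.
    destruct (H t Ht) as [[A B] C]. split; [exact A|].
    eapply Rle_trans; [apply re_le_Cmod|exact C]. }
  assert (B : Rabs (Im (f 1) - Im (f 0)) <= M * Rabs (1 - 0)).
  { apply (bounded_variation (fun s => Im (f s)) (fun s => Im (g s))).
    intros t Ht. replace (1 - 0) with 1 in Ht by ring. rewrite Rabs_R1, Rminus_0_r in Ht.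
    destruct (H t Ht) as [[A' B] C]. split; [exact B|].
    eapply Rle_trans; [|exact C]. eapply Rle_trans; [|apply Rmax_Cmod]. apply Rmax_r. }
  replace (1 - 0) with 1 in A, B by ring. rewrite Rabs_R1 in A, B.
  change (Rabs (Re (f 1) - Re (f 0)) + Rabs (Im (f 1) - Im (f 0)) <= 2 * M). lra.
Qed.

Lemma locally_0_Cmod (P : C -> Prop) :
  locally (0 : C) P -> exists d : R, 0 < d /\ forall z, Cmod z < d -> P z.
Proof.
  intros [d Hd]. exists d; split; [apply cond_pos|].
  intros z Hz. apply Hd. split.
  - change (Rabs (fst z - 0) < d). rewrite Rminus_0_r.
    eapply Rle_lt_trans; [apply re_le_Cmod|exact Hz].
  - change (Rabs (snd z - 0) < d). rewrite Rminus_0_r.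
    eapply Rle_lt_trans; [|exact Hz]. eapply Rle_trans; [|apply Rmax_Cmod]. apply Rmax_r.
Qed.

Lemma filterlim_Ccos {T : Type} (F : (T -> Prop) -> Prop) {FF : Filter F}
  (f : T -> C) (l : C) :
  filterlim f F (locally l) ->
  filterlim (fun x => Ccos (f x)) F (locally (Ccos l)).
Proof.
  intros Hf. apply (filterlim_C F) in Hf. destruct Hf as [A B].
  apply (filterlim_C F); split.
  - apply (filterlim_R_mult F (fun x => cos (Re (f x))) (fun x => cosh (Im (f x))));
      apply (filterlim_R_continuous F); trivial; apply derivable_continuous_pt;
      [apply derivable_cos | apply derivable_cosh].
  - apply (filterlim_R_opp F (fun x => sin (Re (f x)) * sinh (Im (f x)))).
    apply (filterlim_R_mult F (fun x => sin (Re (f x))) (fun x => sinh (Im (f x))));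
      apply (filterlim_R_continuous F); trivial; apply derivable_continuous_pt;
      [apply derivable_sin | apply derivable_sinh].
Qed.

Lemma filterlim_Csin {T : Type} (F : (T -> Prop) -> Prop) {FF : Filter F}
  (f : T -> C) (l : C) :
  filterlim f F (locally l) ->
  filterlim (fun x => Csin (f x)) F (locally (Csin l)).
Proof.
  intros Hf. apply (filterlim_C F) in Hf. destruct Hf as [A B].
  apply (filterlim_C F); split.
  - apply (filterlim_R_mult F (fun x => sin (Re (f x))) (fun x => cosh (Im (f x))));
      apply (filterlim_R_continuous F); trivial; apply derivable_continuous_pt;
      [apply derivable_sin | apply derivable_cosh].
  - apply (filterlim_R_mult F (fun x => cos (Re (f x))) (fun x => sinh (Im (f x))));
      apply (filterlim_R_continuous F); trivial; apply derivable_continuous_pt;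
      [apply derivable_cos | apply derivable_sinh].
Qed.

Lemma filterlim_C_neq_0 {T : Type} (F : (T -> Prop) -> Prop) {FF : Filter F}
  (f : T -> C) (l : C) :
  filterlim f F (locally l) ->
  l <> 0 -> F (fun x => f x <> 0).
Proof.
  intros Hf Hl. apply Cmod_gt_0 in Hl.
  generalize (proj1 (filterlim_C_Cmod F f l) Hf _ Hl). apply filter_imp.
  intros x Hx E. rewrite E in Hx.
  replace (0 - l)%C with (- l)%C in Hx by ring. rewrite Cmod_opp in Hx. lra.
Qed.

Lemma Cmod_scal_le (z : C) (s : R) : Rabs s <= 1 -> Cmod (z * RtoC s)%C <= Cmod z.
Proof.
  intros Hs. rewrite Cmod_mult, Cmod_R. assert (H := Cmod_ge_0 z). nra.
Qed.

(** The difference sin z - z is the increment over [0, 1] of s -> sin (zs) - zs, whose derivative z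
    (cos (zs) - 1) is small relative to |z|. Dividing by |z| gives the estimate. *)
Lemma Csinc_near_0 (eps : R) : 0 < eps ->
  exists d : R, 0 < d /\ forall z, Cmod z < d -> Cmod (Csinc z - 1)%C < eps.
Proof.
  intros He.
  assert (H := filterlim_Ccos (locally (0 : C)) (fun z => z) 0 (filterlim_id _ _)).
  rewrite Ccos_0 in H. rewrite (filterlim_C_Cmod _) in H.
  (* The mean value inequality doubles its bound, so [eps / 4] leaves [eps / 2]. *)
  assert (He4 : 0 < eps / 4) by lra.
  destruct (locally_0_Cmod _ (H _ He4)) as [d [Hd Hd']].
  exists d; split; trivial. intros z Hz.
  destruct (Ceq_dec z 0) as [->|Hz0].
  { rewrite Csinc_0. replace (1 - 1)%C with (RtoC 0) by ring. now rewrite Cmod_0. }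
  assert (B := is_derive_C_bound (fun s => Csin (z * RtoC s) - z * RtoC s)%C
     (fun s => z * Ccos (z * RtoC s) - z * 1)%C (Cmod z * (eps / 4))).
  apply Cmod_gt_0 in Hz0 as Hz1.
  apply (Rmult_lt_reg_l (Cmod z)); trivial.
  rewrite <- Cmod_mult.
  replace (z * (Csinc z - 1))%C
    with ((Csin (z * 1) - z * 1) - (Csin (z * 0) - z * 0))%C.
  2: { replace (z * 0)%C with (RtoC 0) by ring. rewrite Csin_0.
       replace (z * 1)%C with z by ring. rewrite Csin_Csinc. ring. }
  eapply Rle_lt_trans; [apply B|nra].
  intros s Hs; split.
  - apply is_derive_C_minus; [apply is_derive_C_Csin|].
    apply is_derive_C_scal. apply (is_derive_C_RtoC (fun x => x)). auto_derive; trivial.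
  - replace (z * Ccos (z * s) - z * 1)%C with (z * (Ccos (z * s) - 1))%C by ring.
    rewrite Cmod_mult. apply Rmult_le_compat_l; [lra|]. left. apply Hd'.
    eapply Rle_lt_trans; [now apply Cmod_scal_le|exact Hz].
Qed.

Lemma filterlim_Csinc {T : Type} (F : (T -> Prop) -> Prop) {FF : Filter F}
  (f : T -> C) (l : C) :
  filterlim f F (locally l) -> filterlim (fun x => Csinc (f x)) F (locally (Csinc l)).
Proof.
  intros Hf. destruct (Ceq_dec l 0) as [->|Hl].
  - rewrite Csinc_0. apply (filterlim_C_Cmod F). intros eps He.
    destruct (Csinc_near_0 eps He) as [d [Hd Hd']].
    generalize (proj1 (filterlim_C_Cmod F f 0) Hf d Hd). apply filter_imp.
    intros x Hx. apply Hd'. now replace (f x - 0)%C with (f x) in Hx by ring.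
  - rewrite Csinc_eq by trivial.
    eapply filterlim_ext_loc.
    2: apply (filterlim_C_div F (fun x => Csin (f x)) f); trivial; now apply (filterlim_Csin F).
    generalize (filterlim_C_neq_0 F f l Hf Hl). apply filter_imp.
    intros x Hx. simpl. now rewrite Csinc_eq.
Qed.

(** This is cos u - cos v = 2 sin ((v + u)/2) sin ((v - u)/2), with each sine written through sinc
    to display the factor (v + u)(v - u). *)
Lemma Ccos_sub (u v : C) :
  (Ccos u - Ccos v = (v + u) * (v - u) / 2 *
     (Csinc ((v + u) / 2) * Csinc ((v - u) / 2)))%C.
Proof.
  assert (H2 := RtoC_2_neq_0).
  transitivity (2 * (Csin ((v + u) / 2) * Csin ((v - u) / 2)))%C.
  2: rewrite !Csin_Csinc; field; trivial.
  replace (Ccos u) with (Ccos ((v + u) / 2 - (v - u) / 2))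
    by (f_equal; rewrite RtoC_2 in *; field; trivial).
  replace (Ccos v) with (Ccos ((v + u) / 2 + (v - u) / 2))
    by (f_equal; rewrite RtoC_2 in *; field; trivial).
  unfold Cminus at 1 2. rewrite !Ccos_plus, Csin_neg, Ccos_neg.
  rewrite RtoC_2. ring.
Qed.

(** The function s sinc (us): the primitive of s -> cos (us) that vanishes at 0. Its value at s = 1
    is sinc u, also for u = 0. *)
Definition primitive_Ccos (u : C) (s : R) : C :=
  if Ceq_dec u 0 then RtoC s else (/ u * Csin (u * RtoC s))%C.

Lemma primitive_Ccos_0 (u : C) : primitive_Ccos u 0 = 0.
Proof.
  unfold primitive_Ccos. destruct (Ceq_dec u 0); [trivial|].
  replace (u * 0)%C with (RtoC 0) by ring. rewrite Csin_0. ring.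
Qed.

Lemma primitive_Ccos_1 (u : C) : primitive_Ccos u 1 = Csinc u.
Proof.
  unfold primitive_Ccos, Csinc. destruct (Ceq_dec u 0); [trivial|].
  replace (u * 1)%C with u by ring. field; trivial.
Qed.

Lemma is_derive_primitive_Ccos (u : C) (s : R) :
  is_derive_C (primitive_Ccos u) s (Ccos (u * RtoC s)).
Proof.
  unfold primitive_Ccos. destruct (Ceq_dec u 0) as [->|H].
  - replace (0 * s)%C with (RtoC 0) by ring. rewrite Ccos_0.
    apply (is_derive_C_RtoC (fun x => x)). auto_derive; trivial.
  - replace (Ccos (u * s)) with (/ u * (u * Ccos (u * s)))%C by (field; trivial).
    apply is_derive_C_scal, is_derive_C_Csin.
Qed.

(** The left difference of sincs is the integral of cos (us) - cos (vs) over [0, 1]. That integrand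
    is (v + u)(v - u) s^2/2 times a product of two sincs within [eps] of 1, and s^2/2 integrates to
    1/6. The derivative bound [eps / 2] is doubled by the mean value inequality. *)
Lemma Csinc_sub_approx (u v : C) (eps : R) :
  (forall s, Rabs s <= 1 ->
     Cmod (Csinc ((v + u) / 2 * RtoC s) * Csinc ((v - u) / 2 * RtoC s) - 1)%C <= eps) ->
  Cmod (Csinc u - Csinc v - (v + u) * (v - u) * / 6)%C
    <= eps * Cmod ((v + u) * (v - u))%C.
Proof.
  intros H.
  assert (H2 := RtoC_2_neq_0).
  assert (B := is_derive_C_bound
    (fun s => (primitive_Ccos u s - primitive_Ccos v s)
       - ((v + u) * (v - u)) * RtoC (s ^ 3 / 6))%C
    (fun s => (Ccos (u * s) - Ccos (v * s)) - ((v + u) * (v - u)) * RtoC (s ^ 2 / 2))%C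
    (Cmod ((v + u) * (v - u))%C * (eps / 2))).
  cbv beta in B.
  rewrite !primitive_Ccos_0, !primitive_Ccos_1 in B.
  match type of B with _ -> ?X <= _ => match goal with |- ?Y <= _ => replace X with Y in B end end.
  - eapply Rle_trans; [apply B|lra].
    intros s Hs; split.
    + apply is_derive_C_minus.
      * apply is_derive_C_minus; apply is_derive_primitive_Ccos.
      * apply is_derive_C_scal. apply (is_derive_C_RtoC (fun s => s ^ 3 / 6)).
        auto_derive; trivial. field.
    + rewrite Ccos_sub.
      set (S := ((v + u) * (v - u))%C).
      replace (v * s + u * s)%C with ((v + u) * s)%C by ring.
      replace (v * s - u * s)%C with ((v - u) * s)%C by ring.
      replace ((v + u) * s / 2)%C with ((v + u) / 2 * s)%C by (field; trivial).
      replace ((v - u) * s / 2)%C with ((v - u) / 2 * s)%C by (field; trivial).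
      set (P := (Csinc ((v + u) / 2 * s) * Csinc ((v - u) / 2 * s))%C).
      replace ((v + u) * s * ((v - u) * s) / 2 * P - S * RtoC (s ^ 2 / 2))%C
        with (S * (RtoC (s ^ 2 / 2) * (P - 1)))%C.
      2: { unfold S. replace (s ^ 2 / 2) with (s * s / 2) by field.
           rewrite RtoC_div, RtoC_mult by lra. field; trivial. }
      rewrite !Cmod_mult. rewrite Cmod_R.
      specialize (H s Hs). fold P in H.
      apply Rmult_le_compat_l; [apply Cmod_ge_0|].
      rewrite Rabs_pos_eq by (assert (0 <= s ^ 2) by apply pow2_ge_0; lra).
      assert (0 <= s ^ 2 <= 1).
      { split; [apply pow2_ge_0|]. apply Rabs_le_between in Hs. nra. }
      assert (0 <= Cmod (P - 1)%C) by apply Cmod_ge_0. nra.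
  - f_equal. replace (1 ^ 3 / 6) with (/ 6) by field. replace (0 ^ 3 / 6) with 0 by field.
    rewrite RtoC_inv by lra. ring.
Qed.

(** * Real inequalities *)

Lemma derive_pos_lt (f df : R -> R) (a b : R) : a < b ->
  (forall x, a <= x <= b -> is_derive f x (df x)) ->
  (forall x, a < x < b -> 0 < df x) -> f a < f b.
Proof.
  intros Hab Hd Hp.
  destruct (MVT_cor2 f df a b Hab) as [c [Hc1 Hc2]].
  - intros c Hc. apply is_derive_Reals. auto.
  - specialize (Hp c Hc2). nra.
Qed.

Lemma is_derive_sinh (x : R) : is_derive sinh x (cosh x).
Proof. apply is_derive_Reals, derivable_pt_lim_sinh. Qed.

Lemma is_derive_cosh (x : R) : is_derive cosh x (sinh x).
Proof. apply is_derive_Reals, derivable_pt_lim_cosh. Qed.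

Lemma sinh_pos (x : R) : 0 < x -> 0 < sinh x.
Proof. intros H. rewrite <- sinh_0. now apply sinh_lt. Qed.

Lemma cosh_pos (x : R) : 0 < cosh x.
Proof. unfold cosh. assert (H := exp_pos x); assert (H' := exp_pos (- x)). lra. Qed.

Lemma cosh_lt (x y : R) : 0 <= x < y -> cosh x < cosh y.
Proof.
  intros [H1 H2]. apply (derive_pos_lt cosh sinh); trivial.
  - intros z _. apply is_derive_cosh.
  - intros z Hz. apply sinh_pos. lra.
Qed.

Lemma lt_sinh (x : R) : 0 < x -> x < sinh x.
Proof.
  intros Hx.
  assert (H : sinh 0 - 0 < sinh x - x).
  { apply (derive_pos_lt (fun x => sinh x - x) (fun x => cosh x - 1)); trivial.
    - intros z _. apply (is_derive_minus sinh (fun x => x) z (cosh z) 1);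
        [apply is_derive_sinh|auto_derive; trivial].
    - intros z Hz. assert (H := cosh_lt 0 z). rewrite cosh_0 in H. lra. }
  rewrite sinh_0 in H. lra.
Qed.

Lemma sinh_lt_mul_cosh (x : R) : 0 < x -> sinh x < x * cosh x.
Proof.
  intros Hx.
  assert (H : 0 * cosh 0 - sinh 0 < x * cosh x - sinh x).
  { apply (derive_pos_lt (fun x => x * cosh x - sinh x) (fun x => x * sinh x)); trivial.
    - intros z _. unfold cosh, sinh. auto_derive; trivial. field.
    - intros z Hz. apply Rmult_lt_0_compat; [lra|]. apply sinh_pos. lra. }
  rewrite sinh_0 in H. lra.
Qed.

(** With x fixed, z -> x sinh z - z sinh x vanishes at z = x, and for z > x its derivative x cosh z
    - sinh x exceeds x cosh x - sinh x > 0. *)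
Lemma sinh_div_lt (x y : R) : 0 < x < y -> sinh x / x < sinh y / y.
Proof.
  intros [Hx Hxy].
  assert (H : x * sinh x - x * sinh x < x * sinh y - y * sinh x).
  { apply (derive_pos_lt (fun z => x * sinh z - z * sinh x)
      (fun z => x * cosh z - sinh x)); trivial.
    - intros z _. unfold sinh, cosh. auto_derive; trivial. field.
    - intros z Hz. assert (H1 := cosh_lt x z). assert (H2 := sinh_lt_mul_cosh x Hx). nra. }
  apply (Rmult_lt_reg_r (x * y)); [nra|]. field_simplify; lra.
Qed.

Lemma mul_cos_lt_sin (x : R) : 0 < x < PI -> x * cos x < sin x.
Proof.
  intros [Hx HPI].
  assert (H : sin 0 - 0 * cos 0 < sin x - x * cos x).
  { apply (derive_pos_lt (fun x => sin x - x * cos x) (fun x => x * sin x)); trivial.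
    - intros z _. auto_derive; trivial. ring.
    - intros z Hz. apply Rmult_lt_0_compat; [lra|]. apply sin_gt_0; lra. }
  rewrite sin_0 in H. lra.
Qed.

Lemma Rabs_sin_lt (x : R) : 0 < x -> Rabs (sin x) < x.
Proof.
  intros Hx. destruct (Rle_or_lt x PI) as [H|H].
  - rewrite Rabs_pos_eq by (apply sin_ge_0; lra). now apply sin_lt_x.
  - assert (H1 := SIN_bound x). assert (H2 := PI_4). assert (H3 := PI2_1).
    apply Rabs_def1; lra.
Qed.

(** Induction by the addition theorem: |sin ((n+1)u)| <= |sin (nu)| |cos u| + |cos (nu)| sin u. It
    starts at n = 2, where |cos u| < 1 makes the inequality strict; n = 1 would give equality. *)
Lemma Rabs_sin_mul_lt (n : nat) (u : R) : (2 <= n)%nat -> 0 < u < PI ->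
  Rabs (sin (INR n * u)) < INR n * sin u.
Proof.
  intros Hn Hu. assert (Hs : 0 < sin u) by (apply sin_gt_0; lra).
  assert (Hc : Rabs (cos u) < 1).
  { assert (H := sin2_cos2 u). unfold Rsqr in H.
    apply Rabs_def1; nra. }
  induction Hn as [|n Hn IH].
  - simpl INR. replace ((1 + 1) * u) with (2 * u) by ring.
    rewrite sin_2a, !Rabs_mult, (Rabs_pos_eq 2), (Rabs_pos_eq (sin u)) by lra. nra.
  - rewrite S_INR, Rmult_plus_distr_r, Rmult_1_l, sin_plus.
    eapply Rle_lt_trans; [apply Rabs_triang|]. rewrite !Rabs_mult.
    rewrite (Rabs_pos_eq (sin u)) by lra.
    assert (H1 : Rabs (cos (INR n * u)) <= 1).
    { assert (H := COS_bound (INR n * u)). apply Rabs_le; lra. }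
    assert (H2 := Rabs_pos (sin (INR n * u))).
    assert (H3 := Rabs_pos (cos u)). nra.
Qed.

(** * Roots, thetas and the blow-up time *)

(** One formula for both signs of [r], in which the branch choice has disappeared. *)
Lemma Csqrt_RtoC (r : R) :
  Csqrt (RtoC r) = (sqrt ((Rabs r + r) / 2), sqrt ((Rabs r - r) / 2)).
Proof.
  unfold Csqrt. rewrite Cmod_R. simpl.
  destruct (Rle_dec 0 0) as [_|H]; [|lra]. f_equal. ring.
Qed.

Lemma Csqrt_nonneg (r : R) : 0 <= r -> Csqrt (RtoC r) = RtoC (sqrt r).
Proof.
  intros H. rewrite Csqrt_RtoC, Rabs_pos_eq by trivial. unfold RtoC.
  f_equal; [f_equal; field|]. rewrite <- sqrt_0. f_equal. field.
Qed.

Lemma Csqrt_nonpos (r : R) : r <= 0 -> Csqrt (RtoC r) = (0, sqrt (- r)).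
Proof.
  intros H. rewrite Csqrt_RtoC, Rabs_left1 by trivial.
  f_equal; [|f_equal; field]. rewrite <- sqrt_0. f_equal. field.
Qed.

Lemma Cmod_Csqrt (z : C) : Cmod (Csqrt z) = sqrt (Cmod z).
Proof.
  rewrite <- (sqrt_square (Cmod (Csqrt z))) by apply Cmod_ge_0.
  now rewrite <- Cmod_mult, Csqrt_sqr.
Qed.

(** The principal root jumps across the negative axis, but its restriction to the real line is
    continuous. *)
Lemma filterlim_Csqrt_RtoC {T : Type} (F : (T -> Prop) -> Prop) {FF : Filter F}
  (f : T -> R) (l : R) : filterlim f F (locally l) ->
  filterlim (fun x => Csqrt (RtoC (f x))) F (locally (Csqrt (RtoC l))).
Proof.
  intros Hf.
  apply (filterlim_ext (fun x =>
    (sqrt ((Rabs (f x) + f x) / 2), sqrt ((Rabs (f x) - f x) / 2)))).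
  { intros x. now rewrite Csqrt_RtoC. }
  rewrite Csqrt_RtoC. apply (filterlim_C F); simpl.
  assert (Ha : filterlim (fun x => Rabs (f x)) F (locally (Rabs l)))
    by (apply (filterlim_R_continuous F); trivial; apply Rcontinuity_abs).
  split.
  - apply (filterlim_R_continuous F (fun x => (Rabs (f x) + f x) / 2)).
    + apply continuity_pt_sqrt. assert (H := Rle_abs (- l)). rewrite Rabs_Ropp in H. lra.
    + apply (filterlim_R_mult F); [|apply filterlim_const]. now apply (filterlim_R_plus F).
  - apply (filterlim_R_continuous F (fun x => (Rabs (f x) - f x) / 2)).
    + apply continuity_pt_sqrt. assert (H := Rle_abs l). lra.
    + apply (filterlim_R_mult F); [|apply filterlim_const]. apply (filterlim_R_plus F); trivial.
      now apply (filterlim_R_opp F).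
Qed.

(** On either branch the modulus of the root is the square root of the modulus, so the root is
    continuous at the branch point. *)
Lemma filterlim_Csqrt_0 {T : Type} (F : (T -> Prop) -> Prop) {FF : Filter F}
  (f : T -> C) : filterlim f F (locally (0 : C)) ->
  filterlim (fun x => Csqrt (f x)) F (locally (0 : C)).
Proof.
  intros Hf. apply (filterlim_C_Cmod F). intros eps He.
  assert (He2 : 0 < eps * eps) by nra.
  generalize (proj1 (filterlim_C_Cmod F f 0) Hf _ He2). apply filter_imp.
  intros x. replace (f x - 0)%C with (f x) by ring.
  replace (Csqrt (f x) - 0)%C with (Csqrt (f x)) by ring.
  intros Hx. rewrite Cmod_Csqrt, <- (sqrt_square eps) by lra.
  apply sqrt_lt_1_alt. split; [apply Cmod_ge_0|exact Hx].
Qed.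

Section Roots.
Context (ka kb : R).

Definition root_plus : C := Csqrt (par_x kb + par_y ka kb).
Definition root_minus : C := Csqrt (par_x kb - par_y ka kb).

Lemma theta_sum : (theta_plus ka kb + theta_minus ka kb = root_plus)%C.
Proof.
  unfold theta_plus, theta_minus. fold root_plus root_minus.
  assert (H2 := RtoC_2_neq_0). rewrite RtoC_2 in *. field; trivial.
Qed.

Lemma theta_diff : (theta_plus ka kb - theta_minus ka kb = root_minus)%C.
Proof.
  unfold theta_plus, theta_minus. fold root_plus root_minus.
  assert (H2 := RtoC_2_neq_0). rewrite RtoC_2 in *. field; trivial.
Qed.

Lemma par_y_sqr : (par_y ka kb * par_y ka kb = RtoC ((4 * ka + kb ^ 2) / 4))%C.
Proof.
  unfold par_y. assert (H2 := RtoC_2_neq_0).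
  transitivity (Csqrt (RtoC (4 * ka + kb ^ 2)) * Csqrt (RtoC (4 * ka + kb ^ 2)) / (2 * 2))%C.
  - field; trivial.
  - rewrite Csqrt_sqr. rewrite RtoC_div by lra.
    replace (RtoC 4) with (2 * 2)%C; trivial. rewrite <- RtoC_mult. f_equal; ring.
Qed.

(** The squares of the roots multiply to x^2 - y^2 = kb^2/4 - (kb^2 + 4 ka)/4. The product is
    squared because its sign depends on the branches. *)
Lemma root_prod : (root_plus * root_minus * (root_plus * root_minus) = RtoC (- ka))%C.
Proof.
  replace (root_plus * root_minus * (root_plus * root_minus))%C
    with ((root_plus * root_plus) * (root_minus * root_minus))%C by ring.
  unfold root_plus, root_minus. rewrite !Csqrt_sqr.
  replace ((par_x kb + par_y ka kb) * (par_x kb - par_y ka kb))%C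
    with (par_x kb * par_x kb - par_y ka kb * par_y ka kb)%C by ring.
  rewrite par_y_sqr. unfold par_x. rewrite <- RtoC_mult, <- RtoC_minus.
  f_equal. field.
Qed.

(** Sum and difference of the thetas are the two roots, so degeneracy means that a root vanishes,
    and [root_prod] translates this into [ka = 0]. *)
Lemma degenerate_iff : degenerate ka kb <-> ka = 0.
Proof.
  assert (S := theta_sum). assert (D := theta_diff). assert (P := root_prod).
  unfold degenerate. split.
  - intros H. assert (E : RtoC (- ka) = 0).
    { rewrite <- P. destruct H as [H|H]; rewrite H in S, D.
      - replace root_minus with (RtoC 0) by (rewrite <- D; ring). ring.
      - replace root_plus with (RtoC 0) by (rewrite <- S; ring). ring. }
    apply RtoC_inj in E. lra.
  - intros H.
    destruct (Ceq_dec (root_plus) 0) as [Hp|Hp].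
    + right. rewrite Hp in S.
      transitivity (theta_plus ka kb + theta_minus ka kb - theta_minus ka kb)%C; [ring|].
      rewrite S; ring.
    + destruct (Ceq_dec root_minus 0) as [Hm|Hm].
      * left. rewrite Hm in D.
        transitivity (theta_plus ka kb - theta_minus ka kb + theta_minus ka kb)%C; [ring|].
        rewrite D; ring.
      * exfalso. assert (N : (root_plus * root_minus <> 0)%C) by now apply Cmult_neq_0.
        apply (Cmult_neq_0 _ _ N N). rewrite P, H. f_equal; ring.
Qed.

Lemma s_den_degenerate (t : R) : degenerate ka kb -> s_den ka kb t = 0.
Proof.
  unfold s_den. intros [H|H]; rewrite H.
  - ring.
  - replace (- theta_minus ka kb * t)%C with (- (theta_minus ka kb * t))%C by ring.
    rewrite Csinc_neg. ring.
Qed.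

Lemma s_den_neq_0_root (t : R) : s_den ka kb t <> 0 -> (root_plus * root_minus <> 0)%C.
Proof.
  intros H E. apply H, s_den_degenerate, degenerate_iff.
  assert (P := root_prod). rewrite E in P.
  assert (Q : RtoC (- ka) = 0) by (rewrite <- P; ring).
  apply RtoC_inj in Q. lra.
Qed.

(** For [ka <> 0] the limit clause of [s_value] is excluded, and only the formula can supply a
    value. *)
Lemma ex_s_value_nondegenerate (t : R) : ka <> 0 ->
  (exists l, s_value ka kb t l) <-> s_den ka kb t <> 0.
Proof.
  intros Hk. split.
  - intros [l [[H _]|[H _]]]; trivial. now apply degenerate_iff in H.
  - intros H. exists (s_formula ka kb t). left; auto.
Qed.

Lemma roots_real : 0 <= 4 * ka + kb ^ 2 ->
  root_plus = Csqrt (RtoC ((kb + sqrt (4 * ka + kb ^ 2)) / 2)) /\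
  root_minus = Csqrt (RtoC ((kb - sqrt (4 * ka + kb ^ 2)) / 2)).
Proof.
  intros H. unfold root_plus, root_minus, par_x, par_y. rewrite Csqrt_nonneg by trivial.
  rewrite <- RtoC_div, <- RtoC_plus, <- RtoC_minus by lra.
  split; f_equal; f_equal; field.
Qed.

Lemma theta_of_roots (p q : C) : root_plus = (p + q)%C -> root_minus = (q - p)%C ->
  theta_minus ka kb = p /\ theta_plus ka kb = q.
Proof.
  intros Hp Hm. assert (H2 := RtoC_2_neq_0).
  unfold theta_minus, theta_plus. fold root_plus root_minus. rewrite Hp, Hm.
  rewrite RtoC_2 in *. split; field; trivial.
Qed.

Lemma blowup_infinite :
  (forall t, 0 < t -> exists l, s_value ka kb t l) -> blowup_time ka kb = p_infty.
Proof.
  intros H. unfold blowup_time.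
  match goal with |- Lub_Rbar ?E = _ => destruct (Lub_Rbar_correct E) as [U _] end.
  set (L := Lub_Rbar _) in *. clearbody L.
  destruct L as [r| |]; trivial; exfalso.
  - assert (A := U (Rabs r + 1)). simpl in A.
    assert (B : Rabs r + 1 <= r).
    { apply A. split; [assert (P := Rabs_pos r); lra|]. intros t Ht. apply H. lra. }
    assert (C := Rle_abs r). lra.
  (* The end point 0 is always admissible, so the least upper bound is not minus infinity. *)
  - apply (U 0). split; [lra|]. intros; apply H; lra.
Qed.

Lemma blowup_le (t0 : R) : 0 < t0 ->
  ~ (exists l, s_value ka kb t0 l) -> Rbar_le (blowup_time ka kb) t0.
Proof.
  intros Ht H. unfold blowup_time. apply Lub_Rbar_correct.
  intros T [HT1 HT2]. simpl. apply Rnot_lt_le. intros Hlt. apply H, HT2. lra.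
Qed.

Lemma blowup_ge (t0 : R) : 0 <= t0 ->
  (forall t, 0 < t < t0 -> exists l, s_value ka kb t l) -> Rbar_le t0 (blowup_time ka kb).
Proof.
  intros Ht H. unfold blowup_time.
  match goal with |- Rbar_le _ (Lub_Rbar ?E) => destruct (Lub_Rbar_correct E) as [U _] end.
  apply U. split; trivial.
Qed.

Lemma blowup_bound_eq (d : R) : Re (root_plus - root_minus)%C = d ->
  blowup_bound ka kb = if Req_EM_T d 0 then p_infty else Finite (2 * PI / d).
Proof. intros <-. reflexivity. Qed.

End Roots.

(** * Nondegenerate parameters *)

(** The values of sinc on the imaginary axis: sinc (iy). *)
Definition shc (y : R) : R := if Req_EM_T y 0 then 1 else sinh y / y.

Lemma shc_neg (y : R) : shc (- y) = shc y.
Proof.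
  unfold shc. destruct (Req_EM_T (- y) 0), (Req_EM_T y 0); try lra.
  rewrite sinh_neg. field. lra.
Qed.

Lemma shc_lt (x y : R) : 0 <= x < y -> shc x < shc y.
Proof.
  intros [Hx Hxy]. unfold shc.
  destruct (Req_EM_T x 0) as [->|Hx0], (Req_EM_T y 0) as [->|Hy0]; try lra.
  - apply (Rmult_lt_reg_r y); [lra|]. field_simplify; trivial. apply lt_sinh; lra.
  - apply sinh_div_lt. lra.
Qed.

Lemma shc_ge_1 (x : R) : 0 <= x -> 1 <= shc x.
Proof.
  intros Hx. assert (E : shc 0 = 1) by (unfold shc; destruct (Req_EM_T 0 0); lra).
  destruct (Req_EM_T x 0) as [->|H]; [lra|].
  rewrite <- E. left. apply shc_lt. lra.
Qed.

Lemma Csinc_imag (y : R) : Csinc (0, y) = RtoC (shc y).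
Proof.
  unfold shc. destruct (Req_EM_T y 0) as [->|H].
  - apply Csinc_0.
  - rewrite Csinc_eq by (intros E; apply (f_equal snd) in E; simpl in E; lra).
    unfold Csin. simpl. rewrite sin_0, cos_0.
    apply injective_projections; simpl; field; auto.
Qed.

Lemma Csinc_real (x : R) : x <> 0 -> Csinc (RtoC x) = RtoC (sin x / x).
Proof.
  intros H. rewrite Csinc_eq by (intros E; apply RtoC_inj in E; lra).
  unfold Csin. simpl. rewrite cosh_0, sinh_0, RtoC_div by trivial.
  f_equal. apply injective_projections; simpl; ring.
Qed.

Lemma sinc_sqr_lt_1 (x : R) : 0 < x -> (sin x / x) ^ 2 < 1.
Proof.
  intros Hx. assert (H := Rabs_sin_lt x Hx). apply Rabs_def2 in H.
  replace ((sin x / x) ^ 2) with (sin x ^ 2 / x ^ 2) by (field; lra).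
  apply (Rmult_lt_reg_r (x ^ 2)); [nra|]. field_simplify; nra.
Qed.

(** The square of sinc is at least 1 on the imaginary axis and below 1 at nonzero reals, so the
    denominator is positive. *)
Lemma s_den_real_imag (ka kb t p q : R) :
  theta_minus ka kb = (0, q) -> theta_plus ka kb = RtoC p ->
  0 <= q -> 0 < p -> 0 < t -> s_den ka kb t <> 0.
Proof.
  intros Hm Hp Hq Hp0 Ht. unfold s_den. rewrite Hm, Hp.
  replace ((0, q) * t)%C with ((0, q * t) : C) by (apply injective_projections; simpl; ring).
  rewrite <- RtoC_mult, Csinc_imag, Csinc_real by nra.
  rewrite <- !RtoC_pow, <- RtoC_minus. intros E; apply RtoC_inj in E.
  assert (H1 := sinc_sqr_lt_1 (p * t)). assert (H2 := shc_ge_1 (q * t)). nra.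
Qed.

(** On the imaginary axis sinc is even, at least 1 and strictly increasing in |y|, so its squares at
    different heights differ. *)
Lemma s_den_imag (ka kb t p q : R) :
  theta_minus ka kb = (0, - p) -> theta_plus ka kb = (0, q) ->
  0 <= p < q -> 0 < t -> s_den ka kb t <> 0.
Proof.
  intros Hm Hp Hq Ht. unfold s_den. rewrite Hm, Hp.
  replace (Cmult (0, - p) t) with ((0, - (p * t)) : C) by (apply injective_projections; simpl; ring).
  replace ((0, q) * t)%C with ((0, q * t) : C) by (apply injective_projections; simpl; ring).
  rewrite !Csinc_imag, shc_neg.
  rewrite <- !RtoC_pow, <- RtoC_minus. intros E; apply RtoC_inj in E.
  assert (H1 := shc_ge_1 (p * t)). assert (H2 := shc_lt (p * t) (q * t)). nra.
Qed.

Lemma s_den_real (ka kb t p q : R) :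
  theta_minus ka kb = RtoC p -> theta_plus ka kb = RtoC q ->
  0 < p -> 0 < q -> 0 < t ->
  s_den ka kb t =
    RtoC ((q ^ 2 * sin (p * t) ^ 2 - p ^ 2 * sin (q * t) ^ 2) / (p * q * t) ^ 2).
Proof.
  intros Hm Hp Hp0 Hq0 Ht. unfold s_den. rewrite Hm, Hp.
  rewrite <- !RtoC_mult, !Csinc_real by nra.
  rewrite <- !RtoC_pow, <- RtoC_minus. f_equal. field. lra.
Qed.

Lemma s_den_real_eq_0 (ka kb t p q : R) :
  theta_minus ka kb = RtoC p -> theta_plus ka kb = RtoC q ->
  0 < p -> 0 < q -> 0 < t ->
  (s_den ka kb t = 0 <-> q ^ 2 * sin (p * t) ^ 2 - p ^ 2 * sin (q * t) ^ 2 = 0).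
Proof.
  intros Hm Hp Hp0 Hq0 Ht. rewrite (s_den_real ka kb t p q) by trivial.
  assert (N : (p * q * t) ^ 2 <> 0).
  { apply pow_nonzero. assert (0 < p * q) by nra. nra. }
  split.
  - intros E. apply RtoC_inj in E. unfold Rdiv in E.
    apply Rmult_integral in E. destruct E as [E|E]; trivial.
    now apply Rinv_neq_0_compat in E.
  - intros ->. f_equal. field. lra.
Qed.

Lemma IVT_derivable (f : R -> R) (a b : R) : a < b ->
  (forall x, ex_derive f x) -> 0 < f a -> f b < 0 ->
  exists c, a < c < b /\ f c = 0.
Proof.
  intros Hab Hf Ha Hb.
  destruct (IVT_gen f a b 0) as [c [Hc1 Hc2]].
  - intros x. apply continuity_pt_filterlim. exact (ex_derive_continuous f x (Hf x)).
  - rewrite Rmin_right, Rmax_left by lra. lra.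
  - rewrite Rmin_left, Rmax_right in Hc1 by lra.
    exists c; split; trivial.
    split; (apply Rnot_le_lt; intros H; assert (c = a \/ c = b) as [-> | ->] by lra; lra).
Qed.

Lemma blowup_real (ka kb p q : R) : ka <> 0 ->
  theta_minus ka kb = RtoC p -> theta_plus ka kb = RtoC q -> 0 < p < q ->
  Rbar_le (blowup_time ka kb) (PI / p) /\
  (blowup_time ka kb = PI / p <->
   exists n : nat, (2 <= n)%nat /\ theta_plus ka kb = (INR n * theta_minus ka kb)%C).
Proof.
  intros Hk Hm Hp Hpq. assert (HPI := PI_RGT_0).
  assert (Hpp : 0 < PI / p) by (apply Rdiv_lt_0_compat; lra).
  assert (N : forall t, 0 < t -> q ^ 2 * sin (p * t) ^ 2 - p ^ 2 * sin (q * t) ^ 2 = 0 ->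
    Rbar_le (blowup_time ka kb) t).
  { intros t Ht H. apply blowup_le; trivial.
    rewrite ex_s_value_nondegenerate by trivial. intros N; apply N.
    apply (s_den_real_eq_0 ka kb t p q); lra || trivial. }
  (* If this sine vanishes, [PI / p] is itself a zero of the denominator; otherwise the denominator
     is negative there and has an earlier zero. *)
  destruct (Req_EM_T (sin (q * (PI / p))) 0) as [E|E].
  - assert (B : Rbar_le (blowup_time ka kb) (PI / p)).
    { apply N; trivial. rewrite E. replace (p * (PI / p)) with PI by (field; lra).
      rewrite sin_PI. ring. }
    assert (X : exists n : nat, (2 <= n)%nat /\ q = INR n * p).
    (* A zero of sine is an integer multiple of PI, so q = kp; [p < q] forces k > 1. *)
    { destruct (sin_eq_0_0 _ E) as [k Hk'].
      assert (Hq : q = IZR k * p).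
      { apply (Rmult_eq_reg_r (PI / p)); [|lra]. rewrite Hk'. field. lra. }
      assert (H1 : (1 < k)%Z).
      { apply lt_IZR. rewrite Hq in Hpq. apply (Rmult_lt_reg_r p); lra. }
      exists (Z.to_nat k). split; [lia|]. rewrite INR_IZR_INZ, Z2Nat.id by lia. exact Hq. }
    destruct X as [n [Hn Hq]].
    split; trivial. split.
    + intros _. exists n; split; trivial. rewrite Hm, Hp, Hq. now rewrite RtoC_mult.
    + intros _. apply Rbar_le_antisym; trivial.
      apply blowup_ge; [lra|]. intros t Ht.
      apply ex_s_value_nondegenerate; trivial.
      rewrite (s_den_real_eq_0 ka kb t p q) by (lra || trivial).
      assert (Hu : 0 < p * t < PI).
      { split; [nra|]. apply (Rmult_lt_reg_l (/ p)); [apply Rinv_0_lt_compat; lra|].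
        replace (/ p * (p * t)) with t by (field; lra). lra. }
      assert (HS := Rabs_sin_mul_lt n (p * t) Hn Hu).
      rewrite Hq. replace (INR n * p * t) with (INR n * (p * t)) by ring.
      set (S := sin (INR n * (p * t))) in *. set (s := sin (p * t)) in *.
      replace ((INR n * p) ^ 2 * s ^ 2 - p ^ 2 * S ^ 2)
        with (p ^ 2 * ((INR n * s) ^ 2 - S ^ 2)) by ring.
      apply Rabs_def2 in HS. apply Rgt_not_eq. apply Rmult_lt_0_compat; nra.
  - destruct (IVT_derivable (fun t => q ^ 2 * sin (p * t) ^ 2 - p ^ 2 * sin (q * t) ^ 2)
      (PI / q) (PI / p)) as [c [Hc1 Hc2]].
    + apply Rmult_lt_compat_l; trivial. apply Rinv_lt_contravar; nra.
    + intros x. auto_derive; trivial.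
    + replace (q * (PI / q)) with PI by (field; lra). rewrite sin_PI.
      assert (0 < sin (p * (PI / q))).
      { apply sin_gt_0.
        - apply Rmult_lt_0_compat; [lra|]. apply Rdiv_lt_0_compat; lra.
        - apply (Rmult_lt_reg_r q); [lra|].
          replace (p * (PI / q) * q) with (p * PI) by (field; lra).
          rewrite Rmult_comm. apply Rmult_lt_compat_l; lra. }
      set (s := sin (p * (PI / q))) in *.
      replace (q ^ 2 * s ^ 2 - p ^ 2 * 0 ^ 2) with ((q * s) ^ 2) by ring.
      apply pow_lt. nra.
    + replace (p * (PI / p)) with PI by (field; lra). rewrite sin_PI.
      set (S := sin (q * (PI / p))) in *.
      replace (q ^ 2 * 0 ^ 2 - p ^ 2 * S ^ 2) with (- (p * S) ^ 2) by ring.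
      assert (0 < (p * S) ^ 2); [|lra].
      apply pow2_gt_0. apply Rmult_integral_contrapositive. split; lra.
    + assert (0 < PI / q) by (apply Rdiv_lt_0_compat; lra).
      assert (B := N c ltac:(lra) Hc2).
      split.
      * eapply Rbar_le_trans; [exact B|]. simpl. lra.
      (* The zero [c] lies strictly before [PI / p], so equality fails; and q = np would give sin (q
         PI / p) = sin (n PI) = 0. *)
      * split.
        -- intros Heq. rewrite Heq in B. simpl in B. lra.
        -- intros [n [Hn Hq]]. exfalso. rewrite Hm, Hp, <- RtoC_mult in Hq.
           apply RtoC_inj in Hq. apply E. rewrite Hq.
           replace (INR n * p * (PI / p)) with (INR n * PI) by (field; lra).
           apply sin_eq_0_1. exists (Z.of_nat n). now rewrite <- INR_IZR_INZ.
Qed.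

(** For z = p + iq the hypothesis says that sin z times the conjugate of z, hence sinc z, has real
    part 0. Then sinc takes opposite imaginary values at z and its conjugate, and their squares
    agree. *)
Lemma Csinc_sqr_conj (p q : R) : p <> 0 ->
  p * sin p * cosh q + q * cos p * sinh q = 0 ->
  (Csinc (p, (- q)%R) ^ 2 - Csinc (p, q) ^ 2 = 0)%C.
Proof.
  intros Hp H.
  assert (N : p * p + q * q <> 0) by nra.
  rewrite !Csinc_eq by (intros E; apply (f_equal fst) in E; simpl in E; lra).
  (* The sign [s] treats z and its conjugate at once. *)
  assert (E : forall s, Rabs s = 1 ->
    Cdiv (Csin (p, s * q)) (p, s * q) =
    (0, s * ((p * cos p * sinh q - q * sin p * cosh q) / (p * p + q * q)))).
  { intros s Hs.
    assert (Hs' : s = 1 \/ s = -1)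
      by (revert Hs; unfold Rabs; destruct (Rcase_abs s); lra).
    assert (Hsn : sinh (s * q) = s * sinh q /\ cosh (s * q) = cosh q).
    { destruct Hs' as [-> | ->].
      - rewrite !Rmult_1_l. auto.
      - replace (-1 * q) with (- q) by ring. rewrite sinh_neg, cosh_neg. lra. }
    destruct Hsn as [H1 H2]. unfold Csin. simpl. rewrite H1, H2.
    assert (Hss : s * s = 1) by (destruct Hs' as [-> | ->]; ring).
    assert (N' : p * (p * 1) + s * q * (s * q * 1) <> 0) by nra.
    apply injective_projections; simpl.
    - transitivity ((p * sin p * cosh q + (s * s) * (q * cos p * sinh q))
        / (p * (p * 1) + s * q * (s * q * 1))).
      + field. intros X; apply N'; lra.
      + rewrite Hss, Rmult_1_l, H. field. intros X; apply N'; lra.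
    - replace (p * (p * 1) + s * q * (s * q * 1)) with (p * p + (s * s) * (q * q)) by ring.
      rewrite Hss. field. lra. }
  assert (E1 := E 1 Rabs_R1). rewrite !Rmult_1_l in E1.
  assert (E2 := E (-1) ltac:(rewrite Rabs_left; lra)).
  replace (-1 * q) with (- q) in E2 by ring.
  rewrite E1, E2. apply injective_projections; simpl; ring.
Qed.

(** The zero is found strictly before [PI / p], the value of the bound, which rules out equality in
    this case. *)
Lemma blowup_conj (ka kb p q : R) : ka <> 0 ->
  theta_minus ka kb = (p, - q) -> theta_plus ka kb = (p, q) -> 0 < p -> 0 < q ->
  exists c, 0 < c < PI / p /\ Rbar_le (blowup_time ka kb) c.
Proof.
  intros Hk Hm Hp Hp0 Hq0. assert (HPI := PI_RGT_0).
  destruct (IVT_derivable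
     (fun t => p * t * sin (p * t) * cosh (q * t) + q * t * cos (p * t) * sinh (q * t))
     (PI / 2 / p) (PI / p)) as [c [Hc1 Hc2]].
  - apply (Rmult_lt_reg_r p); trivial. field_simplify; lra.
  - intros x. unfold cosh, sinh. auto_derive; trivial.
  (* At the left end the cosine term drops out and the sine term is positive; at the right end only
     the negative term - q t sinh (q t) remains. *)
  - replace (p * (PI / 2 / p)) with (PI / 2) by (field; lra).
    rewrite sin_PI2, cos_PI2. assert (C := cosh_pos (q * (PI / 2 / p))). nra.
  - replace (p * (PI / p)) with PI by (field; lra).
    rewrite sin_PI, cos_PI.
    assert (0 < q * (PI / p)) by (apply Rmult_lt_0_compat, Rdiv_lt_0_compat; lra).
    assert (S := sinh_pos (q * (PI / p)) ltac:(lra)). nra.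
  - assert (0 < PI / 2 / p) by (apply Rdiv_lt_0_compat; lra).
    exists c; split; [lra|]. apply blowup_le; [lra|].
    rewrite ex_s_value_nondegenerate by trivial. intros N; apply N.
    unfold s_den. rewrite Hm, Hp.
    replace (Cmult (p, - q) c) with ((p * c, - (q * c)) : C) by (apply injective_projections; simpl; ring).
    replace ((p, q) * c)%C with ((p * c, q * c) : C) by (apply injective_projections; simpl; ring).
    apply Csinc_sqr_conj; trivial. apply Rgt_not_eq, Rmult_lt_0_compat; lra.
Qed.

(** * Degenerate parameters *)

(** The half sum and half difference of [u] and [v] are small too, so both sincs in
    [Csinc_sub_approx] are close to 1. *)
Lemma Csinc_div_diff_lim {T : Type} (F : (T -> Prop) -> Prop) {FF : Filter F}
  (u v : T -> C) :
  filterlim u F (locally (0 : C)) -> filterlim v F (locally (0 : C)) ->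
  F (fun x => (v x + u x) * (v x - u x) <> 0)%C ->
  filterlim (fun x => (Csinc (u x) - Csinc (v x)) / ((v x + u x) * (v x - u x)))%C
    F (locally (/ 6)%C).
Proof.
  intros Hu Hv HN. apply (filterlim_C_Cmod F). intros eps He.
  (* If a and b are within [eta <= 1] of 1, then |ab - 1| <= eta^2 + 2 eta <= 3 eta <= 3/4 eps. *)
  set (eta := Rmin 1 (eps / 4)).
  assert (Heta : 0 < eta) by (apply Rmin_pos; lra).
  assert (He1 : eta <= 1) by apply Rmin_l. assert (He2 : eta <= eps / 4) by apply Rmin_r.
  destruct (Csinc_near_0 eta Heta) as [d [Hd Hd']].
  generalize (filter_and _ _ HN (filter_and _ _
    (proj1 (filterlim_C_Cmod F _ _) Hu d Hd) (proj1 (filterlim_C_Cmod F _ _) Hv d Hd))).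
  apply filter_imp. intros x [N [Ux Vx]].
  replace (u x - 0)%C with (u x) in Ux by ring.
  replace (v x - 0)%C with (v x) in Vx by ring.
  assert (H2 := RtoC_2_neq_0).
  assert (Hhalf : forall z, Cmod (z / 2)%C = Cmod z / 2).
  { intros z. rewrite Cmod_div, Cmod_R, Rabs_pos_eq by (lra || trivial). trivial. }
  assert (Hp : Cmod ((v x + u x) / 2)%C < d).
  { rewrite Hhalf. assert (Q := Cmod_triangle (v x) (u x)). lra. }
  assert (Hm : Cmod ((v x - u x) / 2)%C < d).
  { rewrite Hhalf. assert (Q := Cmod_triangle (v x) (- u x)%C).
    rewrite Cmod_opp in Q. unfold Cminus. lra. }
  assert (B := Csinc_sub_approx (u x) (v x) (3 / 4 * eps)).
  set (W := ((v x + u x) * (v x - u x))%C) in *.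
  apply Cmod_gt_0 in N as N'.
  replace ((Csinc (u x) - Csinc (v x)) / W - / 6)%C
    with ((Csinc (u x) - Csinc (v x) - W * / 6) * / W)%C.
  2: { field. exact N. }
  rewrite Cmod_mult, Cmod_inv by trivial.
  apply (Rmult_lt_reg_r (Cmod W)); trivial.
  rewrite Rmult_assoc, Rinv_l, Rmult_1_r by lra.
  eapply Rle_lt_trans; [apply B|nra].
  intros s Hs.
  set (a := Csinc ((v x + u x) / 2 * s)). set (b := Csinc ((v x - u x) / 2 * s)).
  assert (Ha : Cmod (a - 1)%C < eta).
  { apply Hd'. eapply Rle_lt_trans; [now apply Cmod_scal_le|exact Hp]. }
  assert (Hb : Cmod (b - 1)%C < eta).
  { apply Hd'. eapply Rle_lt_trans; [now apply Cmod_scal_le|exact Hm]. }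
  replace (a * b - 1)%C with ((a - 1) * (b - 1) + ((a - 1) + (b - 1)))%C by ring.
  eapply Rle_trans; [apply Cmod_triangle|].
  assert (Q := Cmod_triangle (a - 1) (b - 1)). rewrite Cmod_mult.
  assert (Pa := Cmod_ge_0 (a - 1)%C). assert (Pb := Cmod_ge_0 (b - 1)%C). nra.
Qed.

(** The filter of the limit clause of [s_value]. *)
Definition den_filter (ka kb t : R) : (R * R -> Prop) -> Prop :=
  within (fun k : R * R => s_den (fst k) (snd k) t <> 0) (locally (ka, kb)).

Global Instance den_filter_filter ka kb t : Filter (den_filter ka kb t).
Proof. apply within_filter, locally_filter. Qed.

Lemma den_filter_le (ka kb t : R) (P : R * R -> Prop) :
  locally (ka, kb) P -> den_filter ka kb t P.
Proof. unfold den_filter, within. apply filter_imp. auto. Qed.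

Lemma den_filter_den (ka kb t : R) :
  den_filter ka kb t (fun k => s_den (fst k) (snd k) t <> 0).
Proof. unfold den_filter, within. apply filter_forall. auto. Qed.

(** * Limits of the roots and thetas as the parameters vary *)

Lemma filterlim_fst_den (ka kb t : R) :
  filterlim fst (den_filter ka kb t) (locally ka).
Proof.
  intros P HP. apply den_filter_le.
  exact (continuous_fst (U := R_UniformSpace) (V := R_UniformSpace) ka kb P HP).
Qed.

Lemma filterlim_snd_den (ka kb t : R) :
  filterlim snd (den_filter ka kb t) (locally kb).
Proof.
  intros P HP. apply den_filter_le.
  exact (continuous_snd (U := R_UniformSpace) (V := R_UniformSpace) ka kb P HP).
Qed.

Lemma filterlim_disc (ka kb t : R) :
  filterlim (fun k => 4 * fst k + snd k ^ 2) (den_filter ka kb t) (locally (4 * ka + kb ^ 2)).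
Proof.
  apply (filterlim_R_plus _).
  - apply (filterlim_R_mult _); [apply filterlim_const|apply filterlim_fst_den].
  - apply (filterlim_R_mult _); [apply filterlim_snd_den|].
    apply (filterlim_R_mult _); [apply filterlim_snd_den|apply filterlim_const].
Qed.

(** Near (0, kb) the discriminant is positive, so x + y and x - y are real there and the outer root
    is taken along the real axis, where it is continuous. *)
Lemma filterlim_roots_real (kb t : R) : kb <> 0 ->
  filterlim (fun k => root_plus (fst k) (snd k)) (den_filter 0 kb t)
    (locally (Csqrt (RtoC ((kb + Rabs kb) / 2)))) /\
  filterlim (fun k => root_minus (fst k) (snd k)) (den_filter 0 kb t)
    (locally (Csqrt (RtoC ((kb - Rabs kb) / 2)))).
Proof.
  intros Hkb.
  assert (HD := filterlim_disc 0 kb t).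
  assert (Hkb2 : 0 < 4 * 0 + kb ^ 2) by (assert (0 < kb ^ 2) by (apply pow2_gt_0; trivial); lra).
  assert (HP : den_filter 0 kb t (fun k => 0 <= 4 * fst k + snd k ^ 2)).
  { generalize (HD _ (open_gt 0 _ Hkb2)).
    unfold filtermap. apply filter_imp. intros x Hx. lra. }
  assert (HS : filterlim (fun k => sqrt (4 * fst k + snd k ^ 2)) (den_filter 0 kb t)
    (locally (Rabs kb))).
  { replace (Rabs kb) with (sqrt (4 * 0 + kb ^ 2)).
    - apply (filterlim_R_continuous _ (fun k => 4 * fst k + snd k ^ 2)); trivial.
      apply continuity_pt_sqrt. lra.
    - replace (4 * 0 + kb ^ 2) with (Rsqr kb) by (unfold Rsqr; ring). apply sqrt_Rsqr_abs. }
  split.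
  - apply (filterlim_ext_loc (fun k =>
      Csqrt (RtoC ((snd k + sqrt (4 * fst k + snd k ^ 2)) / 2)))).
    + revert HP. apply filter_imp. intros k Hk. symmetry. now apply roots_real.
    + apply (filterlim_Csqrt_RtoC _ (fun k => (snd k + sqrt (4 * fst k + snd k ^ 2)) / 2)).
      apply (filterlim_R_mult _); [|apply filterlim_const].
      apply (filterlim_R_plus _); [apply filterlim_snd_den|exact HS].
  - apply (filterlim_ext_loc (fun k =>
      Csqrt (RtoC ((snd k - sqrt (4 * fst k + snd k ^ 2)) / 2)))).
    + revert HP. apply filter_imp. intros k Hk. symmetry. now apply roots_real.
    + apply (filterlim_Csqrt_RtoC _ (fun k => (snd k - sqrt (4 * fst k + snd k ^ 2)) / 2)).
      apply (filterlim_R_mult _); [|apply filterlim_const].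
      apply (filterlim_R_plus _); [apply filterlim_snd_den|].
      apply (filterlim_R_opp _). exact HS.
Qed.

(** Near the origin x + y and x - y may be nonreal, but they tend to 0, where the root is continuous
    from every direction. *)
Lemma filterlim_roots_0 (t : R) :
  filterlim (fun k => root_plus (fst k) (snd k)) (den_filter 0 0 t) (locally (0 : C)) /\
  filterlim (fun k => root_minus (fst k) (snd k)) (den_filter 0 0 t) (locally (0 : C)).
Proof.
  assert (HD := filterlim_disc 0 0 t).
  assert (H2 := RtoC_2_neq_0).
  assert (Hx : filterlim (fun k => par_x (snd k)) (den_filter 0 0 t) (locally (0 : C))).
  { apply (filterlim_C _); split; simpl; [|apply filterlim_const].
    assert (L := filterlim_R_mult _ _ (fun _ => / 2) _ _ (filterlim_snd_den 0 0 t)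
      (filterlim_const (/ 2))).
    rewrite Rmult_0_l in L. exact L. }
  assert (Hy : filterlim (fun k => par_y (fst k) (snd k)) (den_filter 0 0 t) (locally (0 : C))).
  { replace (RtoC 0) with (Csqrt (RtoC (4 * 0 + 0 ^ 2)) / 2)%C.
    - apply (filterlim_C_div _); trivial; [|apply filterlim_const].
      apply (filterlim_Csqrt_RtoC _ (fun k => 4 * fst k + snd k ^ 2)). exact HD.
    - replace (4 * 0 + 0 ^ 2) with 0 by ring. rewrite Csqrt_nonneg, sqrt_0 by lra.
      field; trivial. }
  split.
  - apply (filterlim_Csqrt_0 _ (fun k => par_x (snd k) + par_y (fst k) (snd k))%C).
    replace (RtoC 0) with (0 + 0)%C by ring. now apply (filterlim_C_plus _).
  - apply (filterlim_Csqrt_0 _ (fun k => par_x (snd k) - par_y (fst k) (snd k))%C).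
    replace (RtoC 0) with (0 - 0)%C by ring. now apply (filterlim_C_minus _).
Qed.

Lemma filterlim_thetas (ka kb t : R) (a b : C) :
  filterlim (fun k => root_plus (fst k) (snd k)) (den_filter ka kb t) (locally a) ->
  filterlim (fun k => root_minus (fst k) (snd k)) (den_filter ka kb t) (locally b) ->
  filterlim (fun k => theta_minus (fst k) (snd k) * t)%C (den_filter ka kb t)
    (locally ((a - b) / 2 * t)%C) /\
  filterlim (fun k => theta_plus (fst k) (snd k) * t)%C (den_filter ka kb t)
    (locally ((a + b) / 2 * t)%C).
Proof.
  intros Ha Hb. assert (H2 := RtoC_2_neq_0).
  split; apply (filterlim_C_mult _); try apply filterlim_const;
    apply (filterlim_C_div _ _ (fun _ => RtoC 2)); trivial; try apply filterlim_const.
  - now apply (filterlim_C_minus _).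
  - now apply (filterlim_C_plus _).
Qed.

(** * Existence of the limit before the blow-up time when [ka = 0] *)

(** The factor AB common to numerator and denominator cancels; what remains can be evaluated when A
    or B is 0. *)
Lemma s_formula_factor (ka kb t : R) :
  let A := (root_plus ka kb * t)%C in let B := (root_minus ka kb * t)%C in
  let u := (theta_minus ka kb * t)%C in let v := (theta_plus ka kb * t)%C in
  s_den ka kb t <> 0 -> u <> 0 -> v <> 0 ->
  s_formula ka kb t = (2 / t * (u * v * num_factor A B / den_factor A B))%C.
Proof.
  intros A B u v Hd Hu Hv. unfold s_formula. f_equal.
  assert (Num : s_num ka kb t = (Csinc (2 * u) - Csinc (2 * v))%C).
  { unfold s_num, u, v. f_equal; f_equal; ring. }
  assert (Den : s_den ka kb t = (Csinc u ^ 2 - Csinc v ^ 2)%C) by reflexivity.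
  assert (HA : (v + u)%C = A).
  { unfold A, u, v. rewrite <- theta_sum. ring. }
  assert (HB : (v - u)%C = B).
  { unfold B, u, v. rewrite <- theta_diff. ring. }
  assert (H2 := RtoC_2_neq_0).
  rewrite Csinc_double_sub, HA, HB in Num by trivial.
  rewrite Csinc_sqr_sub, HA, HB in Den by trivial.
  rewrite Num, Den. rewrite Den in Hd.
  assert (A <> 0 /\ B <> 0 /\ den_factor A B <> 0) as [? [? ?]].
  { repeat split; intros E; apply Hd; rewrite E; field; auto. }
  field. auto.
Qed.

(** After the cancellation every ingredient is continuous; the nonvanishing conditions keep the
    thetas nonzero along the filter and the limiting denominator nonzero. *)
Lemma ex_limit_factor (ka kb t : R) (a b : C) : 0 < t ->
  filterlim (fun k => root_plus (fst k) (snd k)) (den_filter ka kb t) (locally a) ->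
  filterlim (fun k => root_minus (fst k) (snd k)) (den_filter ka kb t) (locally b) ->
  (a - b <> 0)%C -> (a + b <> 0)%C -> den_factor (a * t) (b * t) <> 0 ->
  exists l : C, filterlim (fun k => s_formula (fst k) (snd k) t)
    (den_filter ka kb t) (locally l).
Proof.
  intros Ht Ha Hb Hm Hp HE. assert (H2 := RtoC_2_neq_0).
  assert (Ht' : RtoC t <> 0) by (intros E; apply RtoC_inj in E; lra).
  destruct (filterlim_thetas ka kb t a b Ha Hb) as [Lu Lv].
  assert (LA : filterlim (fun k => root_plus (fst k) (snd k) * t)%C (den_filter ka kb t) (locally (a * t)%C))
    by (apply (filterlim_C_mult _); [exact Ha|apply filterlim_const]).
  assert (LB : filterlim (fun k => root_minus (fst k) (snd k) * t)%C (den_filter ka kb t) (locally (b * t)%C))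
    by (apply (filterlim_C_mult _); [exact Hb|apply filterlim_const]).
  set (u := fun k : R * R => (theta_minus (fst k) (snd k) * t)%C) in *.
  set (v := fun k : R * R => (theta_plus (fst k) (snd k) * t)%C) in *.
  set (A := fun k : R * R => (root_plus (fst k) (snd k) * t)%C) in *.
  set (B := fun k : R * R => (root_minus (fst k) (snd k) * t)%C) in *.
  assert (Nu : den_filter ka kb t (fun k => u k <> 0)).
  { apply (filterlim_C_neq_0 _ _ _ Lu). intros E. apply Hm.
    replace (a - b)%C with ((a - b) / 2 * t * (2 / t))%C by (field; auto). rewrite E. ring. }
  assert (Nv : den_filter ka kb t (fun k => v k <> 0)).
  { apply (filterlim_C_neq_0 _ _ _ Lv). intros E. apply Hp.
    replace (a + b)%C with ((a + b) / 2 * t * (2 / t))%C by (field; auto). rewrite E. ring. }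
  set (F := den_filter ka kb t) in *.
  assert (SA := filterlim_Csinc F A _ LA). assert (SB := filterlim_Csinc F B _ LB).
  assert (CA := filterlim_Ccos F A _ LA). assert (CB := filterlim_Ccos F B _ LB).
  assert (LN := filterlim_C_minus F _ _ _ _ (filterlim_C_mult F _ _ _ _ SA CB)
    (filterlim_C_mult F _ _ _ _ CA SB)).
  assert (LE := filterlim_C_minus F _ _ _ _
    (filterlim_C_minus F _ _ _ _ (filterlim_const (1 : C)) (filterlim_C_mult F _ _ _ _ CA CB))
    (filterlim_C_mult F _ _ _ _
      (filterlim_C_div F _ _ _ _ H2 (filterlim_C_plus F _ _ _ _
        (filterlim_C_mult F _ _ _ _ LA LA) (filterlim_C_mult F _ _ _ _ LB LB))
        (filterlim_const (RtoC 2)))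
      (filterlim_C_mult F _ _ _ _ SA SB))).
  assert (LQ := filterlim_C_mult F _ _ _ _ (filterlim_const (2 / t)%C)
    (filterlim_C_div F _ _ _ _ HE
      (filterlim_C_mult F _ _ _ _ (filterlim_C_mult F _ _ _ _ Lu Lv) LN) LE)).
  eexists. eapply filterlim_ext_loc; [|exact LQ].
  generalize (filter_and _ _ Nu (filter_and _ _ Nv (den_filter_den ka kb t))).
  apply filter_imp. intros k [Hu [Hv Hk]]. symmetry. now apply s_formula_factor.
Qed.

(** The value is 1 - cos 2w - w sin 2w = 2 sin w (sin w - w cos w), a product of positive
    factors. *)
Lemma den_factor_real (w : R) : 0 < w < PI -> den_factor (RtoC (2 * w)) 0 <> 0.
Proof.
  intros Hw. unfold den_factor. rewrite Csinc_0, Ccos_0, Csinc_real by lra.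
  replace (Ccos (RtoC (2 * w))) with (RtoC (cos (2 * w))).
  2: { unfold Ccos. simpl. rewrite cosh_0, sinh_0. unfold RtoC. f_equal; ring. }
  assert (H := mul_cos_lt_sin w Hw).
  assert (Hs : 0 < sin w) by (apply sin_gt_0; lra).
  intros E. apply (f_equal Re) in E.
  assert (Q : 2 * sin w * (sin w - w * cos w) = 0).
  { rewrite <- E at 1. rewrite sin_2a, cos_2a_sin. simpl. field. lra. }
  assert (0 < sin w - w * cos w) by lra.
  assert (0 < 2 * sin w * (sin w - w * cos w)) by (apply Rmult_lt_0_compat; lra). lra.
Qed.

(** Hyperbolic counterpart: the value is 2 sinh w (w cosh w - sinh w) > 0. *)
Lemma den_factor_imag (w : R) : 0 < w -> den_factor 0 (0, 2 * w) <> 0.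
Proof.
  intros Hw. unfold den_factor. rewrite Csinc_0, Ccos_0, Csinc_imag.
  unfold shc. destruct (Req_EM_T (2 * w) 0); [lra|].
  replace (Ccos (0, 2 * w)) with (RtoC (cosh (2 * w))).
  2: { unfold Ccos. simpl. rewrite cos_0, sin_0. unfold RtoC. f_equal; ring. }
  assert (H := sinh_lt_mul_cosh w Hw). assert (Hs := sinh_pos w Hw).
  intros E. apply (f_equal Re) in E.
  assert (Q : 2 * sinh w * (w * cosh w - sinh w) = 0).
  { rewrite <- E at 1. replace (2 * w) with (w + w) by ring.
    rewrite sinh_plus, cosh_plus, cosh_sqr. simpl. field. lra. }
  assert (0 < 2 * sinh w * (w * cosh w - sinh w)) by (apply Rmult_lt_0_compat; lra). lra.
Qed.

(** At [ka = 0] the denominator is 0 for every [t], so the formula clause of [s_value] is void. *)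
Lemma s_value_limit (kb t : R) (l : C) :
  filterlim (fun k => s_formula (fst k) (snd k) t) (den_filter 0 kb t) (locally l) <->
  s_value 0 kb t l.
Proof.
  assert (D : degenerate 0 kb) by now apply degenerate_iff.
  split.
  - intros H. right. split; trivial.
  - intros [[H _]|[_ H]]; [|exact H].
    exfalso; apply H. now apply s_den_degenerate.
Qed.

Lemma limit_pos (kb t : R) : 0 < kb -> 0 < t < 2 * PI / sqrt kb ->
  exists l, s_value 0 kb t l.
Proof.
  intros Hkb Ht. assert (Hs := sqrt_lt_R0 kb Hkb).
  destruct (filterlim_roots_real kb t) as [Ha Hb]; [lra|].
  rewrite Rabs_pos_eq in Ha, Hb by lra.
  replace ((kb + kb) / 2) with kb in Ha by field.
  replace ((kb - kb) / 2) with 0 in Hb by field.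
  rewrite Csqrt_nonneg in Ha, Hb by lra. rewrite sqrt_0 in Hb.
  assert (N : RtoC (sqrt kb) <> 0) by (intros E; apply RtoC_inj in E; lra).
  destruct (ex_limit_factor 0 kb t (RtoC (sqrt kb)) 0) as [l Hl]; trivial; try lra.
  - now replace (sqrt kb - 0)%C with (RtoC (sqrt kb)) by ring.
  - now replace (sqrt kb + 0)%C with (RtoC (sqrt kb)) by ring.
  - replace (0 * t)%C with (RtoC 0) by ring. rewrite <- RtoC_mult.
    (* With w = sqrt kb t/2, the condition w < PI is exactly t < 2 PI / sqrt kb. *)
    replace (sqrt kb * t) with (2 * (sqrt kb * t / 2)) by field.
    apply den_factor_real. split.
    + assert (0 < sqrt kb * t) by (apply Rmult_lt_0_compat; lra). lra.
    + destruct Ht as [_ Ht]. apply (Rmult_lt_compat_l (sqrt kb)) in Ht; trivial.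
      replace (sqrt kb * (2 * PI / sqrt kb)) with (2 * PI) in Ht by (field; lra). lra.
  - exists l. now apply s_value_limit.
Qed.

(** For [kb < 0] the limits of the roots are 0 and an imaginary number, and [den_factor_imag]
    applies at every positive time. *)
Lemma limit_neg (kb t : R) : kb < 0 -> 0 < t -> exists l, s_value 0 kb t l.
Proof.
  intros Hkb Ht. assert (Hs := sqrt_lt_R0 (- kb) ltac:(lra)).
  destruct (filterlim_roots_real kb t) as [Ha Hb]; [lra|].
  rewrite Rabs_left in Ha, Hb by lra.
  replace ((kb + - kb) / 2) with 0 in Ha by field.
  replace ((kb - - kb) / 2) with kb in Hb by field.
  rewrite Csqrt_nonneg, sqrt_0 in Ha by lra. rewrite Csqrt_nonpos in Hb by lra.
  assert (N : forall s, s <> 0 -> ((0, s) : C) <> 0).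
  { intros s Hs' E. apply (f_equal snd) in E. simpl in E. lra. }
  destruct (ex_limit_factor 0 kb t 0 (0, sqrt (- kb))) as [l Hl]; trivial; try lra.
  - replace (0 - (0, sqrt (- kb)%R))%C with ((0, - sqrt (- kb)) : C)
      by (apply injective_projections; simpl; ring). apply N. lra.
  - replace (0 + (0, sqrt (- kb)%R))%C with ((0, sqrt (- kb)) : C)
      by (apply injective_projections; simpl; ring). apply N. lra.
  - replace (0 * t)%C with (RtoC 0) by ring.
    replace (Cmult (0, sqrt (- kb)) t) with ((0, 2 * (sqrt (- kb) * t / 2)) : C)
      by (apply injective_projections; simpl; field).
    apply den_factor_imag. assert (0 < sqrt (- kb) * t) by (apply Rmult_lt_0_compat; lra). lra.
  - exists l. now apply s_value_limit.
Qed.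

(** Both thetas tend to 0, so [ex_limit_factor] does not apply. The denominator is split as (sinc u
    - sinc v)(sinc u + sinc v), and both sides of the fraction are divided by W = (v + u)(v - u). *)
Lemma limit_zero (t : R) : 0 < t -> exists l, s_value 0 0 t l.
Proof.
  intros Ht. assert (H2 := RtoC_2_neq_0).
  assert (Ht' : RtoC t <> 0) by (intros E; apply RtoC_inj in E; lra).
  assert (H6 : RtoC 6 <> 0) by (intros E; apply RtoC_inj in E; lra).
  destruct (filterlim_roots_0 t) as [Ha Hb].
  destruct (filterlim_thetas 0 0 t 0 0 Ha Hb) as [Lu Lv].
  replace ((0 - 0) / 2 * t)%C with (RtoC 0) in Lu by (field; trivial).
  replace ((0 + 0) / 2 * t)%C with (RtoC 0) in Lv by (field; trivial).
  set (u := fun k : R * R => (theta_minus (fst k) (snd k) * t)%C) in *.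
  set (v := fun k : R * R => (theta_plus (fst k) (snd k) * t)%C) in *.
  assert (HW : den_filter 0 0 t (fun k => (v k + u k) * (v k - u k) <> 0)%C).
  { generalize (den_filter_den 0 0 t). apply filter_imp. intros k Hk.
    apply s_den_neq_0_root in Hk.
    replace ((v k + u k) * (v k - u k))%C
      with (root_plus (fst k) (snd k) * root_minus (fst k) (snd k) * (t * t))%C
      by (unfold u, v; rewrite <- theta_sum, <- theta_diff; ring).
    apply Cmult_neq_0; trivial. now apply Cmult_neq_0. }
  set (W := fun k => ((v k + u k) * (v k - u k))%C) in *.
  assert (J1 := Csinc_div_diff_lim (den_filter 0 0 t) u v Lu Lv HW).
  assert (D2 : forall f : R * R -> C, filterlim f (den_filter 0 0 t) (locally (0 : C)) ->
     filterlim (fun k => 2 * f k)%C (den_filter 0 0 t) (locally (0 : C))).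
  { intros f Hf. replace (RtoC 0) with (2 * 0)%C by ring.
    apply (filterlim_C_mult _ (fun _ => RtoC 2)); trivial. apply filterlim_const. }
  assert (J2 := Csinc_div_diff_lim (den_filter 0 0 t) (fun k => 2 * u k)%C
    (fun k => 2 * v k)%C (D2 _ Lu) (D2 _ Lv)).
  cbv beta in J1, J2.
  assert (LS : filterlim (fun k => Csinc (u k) + Csinc (v k))%C (den_filter 0 0 t)
     (locally (1 + 1)%C)).
  { rewrite <- Csinc_0. apply (filterlim_C_plus _ (fun k => Csinc (u k)));
    now apply (filterlim_Csinc _). }
  assert (N6 : (/ 6 * (1 + 1) <> 0)%C).
  { apply Cmult_neq_0.
    - intros E. assert (Q : (6 * / 6)%C = 0) by (rewrite E; ring).
      rewrite Cinv_r in Q by trivial. apply RtoC_inj in Q. lra.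
    - rewrite <- RtoC_2. trivial. }
  assert (HW2 : den_filter 0 0 t
    (fun k => (2 * v k + 2 * u k) * (2 * v k - 2 * u k) <> 0)%C).
  { revert HW. apply filter_imp. intros k Hk.
    replace ((2 * v k + 2 * u k) * (2 * v k - 2 * u k))%C with (2 * 2 * W k)%C
      by (unfold W; ring).
    apply Cmult_neq_0; [now apply Cmult_neq_0|exact Hk]. }
  (* Doubling the arguments turns W into 4W, whence the factor 4. The limit is (2/t) (4/6) / (2/6) =
     4/t. *)
  assert (LQ := filterlim_C_mult _ _ _ _ _ (filterlim_const (2 / t)%C)
    (filterlim_C_div _ _ _ _ _ N6
      (filterlim_C_mult _ _ _ _ _ (filterlim_const (RtoC 4)) (J2 HW2))
      (filterlim_C_mult _ _ _ _ _ J1 LS))).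
  eexists. apply s_value_limit. eapply filterlim_ext_loc; [|exact LQ].
  generalize (filter_and _ _ HW (den_filter_den 0 0 t)). apply filter_imp.
  intros k [Hw Hk]. cbv beta.
  unfold s_formula. f_equal.
  replace (s_num (fst k) (snd k) t) with (Csinc (2 * u k) - Csinc (2 * v k))%C.
  2: { unfold s_num, u, v. f_equal; f_equal; ring. }
  assert (Den : s_den (fst k) (snd k) t
     = ((Csinc (u k) - Csinc (v k)) * (Csinc (u k) + Csinc (v k)))%C)
    by (unfold s_den; fold (u k) (v k); simpl; ring).
  rewrite Den in Hk |- *.
  assert (Csinc (u k) - Csinc (v k) <> 0)%C by (intros E; apply Hk; rewrite E; ring).
  assert (Csinc (u k) + Csinc (v k) <> 0)%C by (intros E; apply Hk; rewrite E; ring).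
  replace ((2 * v k + 2 * u k) * (2 * v k - 2 * u k))%C with (4 * W k)%C.
  2: { unfold W. replace 4 with (2 * 2) by ring. rewrite RtoC_mult. ring. }
  change ((v k + u k) * (v k - u k))%C with (W k). field.
  repeat split; trivial.
Qed.

(** * Absence of a limit at 2 PI / sqrt kb *)

(** Recovers parameters from prescribed thetas: here 4 ka + kb^2 = (4pq)^2, so x + y = (p + q)^2 and
    x - y = (q - p)^2. *)
Lemma theta_param (p q : R) : 0 < p <= q ->
  theta_minus (- (q ^ 2 - p ^ 2) ^ 2) (2 * (p ^ 2 + q ^ 2)) = RtoC p /\
  theta_plus (- (q ^ 2 - p ^ 2) ^ 2) (2 * (p ^ 2 + q ^ 2)) = RtoC q.
Proof.
  intros Hpq.
  set (ka := - (q ^ 2 - p ^ 2) ^ 2). set (kb := 2 * (p ^ 2 + q ^ 2)).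
  assert (E : 4 * ka + kb ^ 2 = (4 * p * q) * (4 * p * q)) by (unfold ka, kb; ring).
  assert (P : 0 <= 4 * p * q) by nra.
  destruct (roots_real ka kb) as [R1 R2]; [rewrite E; nra|].
  rewrite E, sqrt_square in R1, R2 by trivial.
  replace ((kb + 4 * p * q) / 2) with ((p + q) * (p + q)) in R1 by (unfold kb; field).
  replace ((kb - 4 * p * q) / 2) with ((q - p) * (q - p)) in R2 by (unfold kb; field).
  rewrite Csqrt_nonneg, sqrt_square in R1 by nra.
  rewrite Csqrt_nonneg, sqrt_square in R2 by nra.
  apply theta_of_roots.
  - now rewrite R1, RtoC_plus.
  - now rewrite R2, RtoC_minus.
Qed.

Lemma no_limit_at_bound (kb : R) : 0 < kb ->
  ~ exists l, s_value 0 kb (2 * PI / sqrt kb) l.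
Proof.
  intros Hkb [l Hl]. apply s_value_limit in Hl.
  assert (Hs := sqrt_lt_R0 kb Hkb). assert (HPI := PI_RGT_0).
  set (t := 2 * PI / sqrt kb) in *.
  assert (Ht : 0 < t) by (apply Rdiv_lt_0_compat; lra).
  set (p := PI / t).
  assert (Hp : 0 < p) by (apply Rdiv_lt_0_compat; lra).
  assert (Hpt : p * t = PI) by (unfold p; field; lra).
  assert (Hkbp : kb = 2 * (p ^ 2 + p ^ 2)).
  { replace p with (sqrt kb / 2) by (unfold p, t; field; lra).
    rewrite <- (sqrt_sqrt kb) at 1 by lra. field. }
  (* A curve of parameters reaching (0, kb) at e = 0, along which the thetas are p and p + e. *)
  set (g := fun e : R => (- ((p + e) ^ 2 - p ^ 2) ^ 2, 2 * (p ^ 2 + (p + e) ^ 2))).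
  set (w := fun e : R => (p + e) * t).
  assert (ToR : forall P : R -> Prop, locally 0 P -> at_right 0 P).
  { intros P. unfold at_right, within. apply filter_imp. auto. }
  (* These conditions put [w e] strictly between PI and 2 PI, where sine does not vanish. *)
  assert (Near : at_right 0 (fun e => 0 < e /\ e * t < PI)).
  { assert (Hpp : 0 < p) by trivial. exists (mkposreal p Hpp). intros e He He0. split; trivial.
    change (Rabs (e - 0) < p) in He. rewrite Rminus_0_r in He. apply Rabs_def2 in He.
    rewrite <- Hpt. apply Rmult_lt_compat_r; lra. }
  assert (Hsin : forall e, 0 < e /\ e * t < PI -> sin (w e) <> 0).
  { intros e [He1 He2]. unfold w. rewrite Rmult_plus_distr_r, Hpt, Rplus_comm, neg_sin.
    assert (0 < sin (e * t)) by (apply sin_gt_0; nra). lra. }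
  assert (Hth : forall e, 0 < e /\ e * t < PI ->
    theta_minus (fst (g e)) (snd (g e)) = RtoC p /\
    theta_plus (fst (g e)) (snd (g e)) = RtoC (p + e)).
  { intros e [He1 He2]. apply theta_param. lra. }
  assert (Hden : forall e, 0 < e /\ e * t < PI ->
    s_den (fst (g e)) (snd (g e)) t = RtoC (- (sin (w e) / w e) ^ 2)).
  { intros e He. destruct (Hth e He) as [T1 T2]. destruct He.
    rewrite (s_den_real _ _ _ p (p + e)) by (lra || trivial).
    rewrite Hpt, sin_PI. unfold w. f_equal. field. lra. }
  assert (Hw : forall e, 0 < e /\ e * t < PI -> w e <> 0).
  { intros e He. unfold w. assert (0 < (p + e) * t) by (apply Rmult_lt_0_compat; lra). lra. }
  assert (Hform : forall e, 0 < e /\ e * t < PI ->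
    s_formula (fst (g e)) (snd (g e)) t = RtoC (2 / t * (w e * cos (w e) / sin (w e)))).
  { intros e He. assert (W := Hw e He). assert (S := Hsin e He).
    unfold s_formula. rewrite Hden by trivial.
    destruct (Hth e He) as [T1 T2]. unfold s_num. rewrite T1, T2.
    rewrite <- !RtoC_mult. rewrite Rmult_assoc, Hpt.
    replace (2 * (p + e) * t) with (2 * w e) by (unfold w; ring).
    rewrite !Csinc_real by lra. rewrite sin_2PI, sin_2a.
    assert (N : - (sin (w e) / w e) ^ 2 <> 0).
    { apply Ropp_neq_0_compat, pow_nonzero. unfold Rdiv.
      apply Rmult_integral_contrapositive. split; trivial. now apply Rinv_neq_0_compat. }
    rewrite <- RtoC_minus, <- !RtoC_div, <- RtoC_mult by (lra || trivial).
    f_equal. field. repeat split; lra || trivial. }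
  (* The denominator is nonzero along the curve, so the curve is admissible for the limit defining
     the value. *)
  assert (Lg : filterlim g (at_right 0) (den_filter 0 kb t)).
  { intros P HP. unfold den_filter, within in HP.
    assert (Lg0 : filterlim g (at_right 0) (locally (0, kb))).
    { intros Q HQ. apply ToR.
      assert (C : continuous g 0).
      { apply (continuous_comp_2 (fun e => - ((p + e) ^ 2 - p ^ 2) ^ 2)
          (fun e => 2 * (p ^ 2 + (p + e) ^ 2)) (fun x y => (x, y)) 0).
        - apply (ex_derive_continuous (V := R_NormedModule)). auto_derive; trivial.
        - apply (ex_derive_continuous (V := R_NormedModule)). auto_derive; trivial.
        - apply (continuous_ext (fun z => z)); [intros [x y]; trivial|]. apply continuous_id. }
      replace (0, kb) with (g 0) in HQ; [exact (C Q HQ)|].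
      unfold g. rewrite Hkbp. f_equal; ring. }
    specialize (Lg0 _ HP). unfold filtermap in *.
    generalize (filter_and _ _ Lg0 Near). apply filter_imp. intros e [H1 H2].
    apply H1. rewrite Hden by trivial. intros E. apply RtoC_inj in E.
    assert (S := Hsin e H2). assert (W := Hw e H2).
    assert (N : (sin (w e) / w e) ^ 2 <> 0); [|lra].
    apply pow_nonzero. unfold Rdiv.
    apply Rmult_integral_contrapositive. split; trivial. now apply Rinv_neq_0_compat. }
  assert (Lf := filterlim_comp _ _ _ _ _ _ _ _ Lg Hl).
  apply (filterlim_C _) in Lf. destruct Lf as [Lf _].
  assert (Lw : forall h : R -> R, continuity_pt h PI ->
    filterlim (fun e => h (w e)) (at_right 0) (locally (h PI))).
  { intros h Hh. apply (filterlim_R_continuous _ w); trivial.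
    intros Q HQ. apply ToR.
    replace PI with (w 0) in HQ by (unfold w; rewrite Rplus_0_r; trivial).
    revert Q HQ. apply (ex_derive_continuous (V := R_NormedModule) w 0).
    unfold w. auto_derive; trivial. }
  (* Multiplying by sin w removes the pole: a finite limit would force 0, while the explicit formula
     tends to - 2 PI / t. *)
  assert (L1 := filterlim_R_mult _ _ _ _ _ Lf (Lw sin (derivable_continuous_pt _ _ (derivable_sin PI)))).
  assert (L2 := Lw (fun x => 2 / t * (x * cos x))).
  assert (C2 : continuity_pt (fun x => 2 / t * (x * cos x)) PI).
  { apply continuity_pt_filterlim.
    apply (ex_derive_continuous (V := R_NormedModule) (fun x => 2 / t * (x * cos x))).
    auto_derive; trivial. }
  specialize (L2 C2). cbv beta in L2. rewrite cos_PI in L2. rewrite sin_PI in L1.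
  assert (L3 : filterlim (fun e => 2 / t * (w e * cos (w e))) (at_right 0) (locally (Re l * 0))).
  { eapply filterlim_ext_loc; [|exact L1]. revert Near. apply filter_imp.
    intros e He. cbv beta. rewrite Hform by trivial. simpl. field.
    split; [lra|now apply Hsin]. }
  assert (E := filterlim_locally_unique _ _ _ L2 L3).
  assert (0 < 2 / t) by (apply Rdiv_lt_0_compat; lra). nra.
Qed.

(** * Values of the bound *)

Lemma blowup_bound_infinite (ka kb : R) :
  Re (root_plus ka kb) = Re (root_minus ka kb) -> blowup_bound ka kb = p_infty.
Proof.
  intros H. rewrite (blowup_bound_eq ka kb 0).
  - destruct (Req_EM_T 0 0); tauto.
  - change (Re (root_plus ka kb) - Re (root_minus ka kb) = 0). lra.
Qed.

(** The difference of the roots is twice [theta_minus]. *)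
Lemma blowup_bound_theta (ka kb p : R) : 0 < p ->
  Re (theta_minus ka kb) = p -> blowup_bound ka kb = Finite (PI / p).
Proof.
  intros Hp H. rewrite (blowup_bound_eq ka kb (2 * p)).
  - destruct (Req_EM_T (2 * p) 0); [lra|]. f_equal. field. lra.
  - rewrite <- H, <- theta_sum, <- theta_diff. simpl. ring.
Qed.

(** Now y is purely imaginary, so x + y and x - y are conjugate and off the real axis; their
    principal roots are conjugate with nonzero real and imaginary parts. *)
Lemma roots_disc_neg (ka kb : R) : 4 * ka + kb ^ 2 < 0 ->
  exists p q : R, 0 < p /\ 0 < q /\ root_plus ka kb = (p, q) /\ root_minus ka kb = (p, - q).
Proof.
  intros HD.
  assert (Hs := sqrt_lt_R0 (- (4 * ka + kb ^ 2)) ltac:(lra)).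
  set (v := sqrt (- (4 * ka + kb ^ 2)) / 2).
  assert (Hv : 0 < v) by (unfold v; lra).
  assert (Hy : par_y ka kb = (0, v)).
  { unfold par_y. rewrite Csqrt_nonpos by lra.
    unfold v. set (s := sqrt _).
    apply injective_projections; simpl; field. }
  set (m := Cmod (kb / 2, v)).
  assert (Hm : Rabs (kb / 2) < m).
  { unfold m, Cmod. rewrite <- sqrt_Rsqr_abs. apply sqrt_lt_1_alt.
    unfold Rsqr. simpl. split; nra. }
  apply Rabs_def2 in Hm.
  exists (sqrt ((m + kb / 2) / 2)), (sqrt ((m - kb / 2) / 2)).
  repeat split; try (apply sqrt_lt_R0; lra).
  - unfold root_plus, par_x. rewrite Hy.
    replace (RtoC (kb / 2) + (0, v))%C with ((kb / 2, v) : C)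
      by (apply injective_projections; simpl; ring).
    unfold Csqrt. fold m. simpl. destruct (Rle_dec 0 v); [|lra]. f_equal; ring.
  - unfold root_minus, par_x. rewrite Hy.
    replace (RtoC (kb / 2) - (0, v))%C with (Cconj (kb / 2, v))
      by (apply injective_projections; simpl; ring).
    unfold Csqrt. rewrite Cmod_conj. fold m. simpl.
    destruct (Rle_dec 0 (- v)); [lra|]. f_equal; ring.
Qed.

(** * Blow-up time and bound according to the signs of the parameters *)

(** A negative discriminant makes [theta_plus] real and [theta_minus] imaginary; otherwise [kb < 0]
    makes both imaginary. In the remaining case the discriminant is 0 and [theta_minus] vanishes. In
    all three the roots have equal real parts, so the bound is infinite as well. *)
Lemma blowup_ka_neg_infinite (ka kb : R) : ka < 0 ->
  4 * ka + kb ^ 2 <= 0 \/ kb < 0 ->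
  blowup_time ka kb = p_infty /\ blowup_bound ka kb = p_infty.
Proof.
  intros Hk Hc.
  assert (G : (forall t, 0 < t -> s_den ka kb t <> 0) -> blowup_time ka kb = p_infty).
  { intros H. apply blowup_infinite. intros t Ht.
    apply ex_s_value_nondegenerate; [lra|auto]. }
  destruct (Rlt_or_le (4 * ka + kb ^ 2) 0) as [HD|HD].
  - destruct (roots_disc_neg ka kb HD) as [p [q [Hp [Hq [Rp Rm]]]]].
    split; [|apply blowup_bound_infinite; now rewrite Rp, Rm].
    destruct (theta_of_roots ka kb (0, q) (RtoC p)) as [T1 T2].
    { rewrite Rp. apply injective_projections; simpl; ring. }
    { rewrite Rm. apply injective_projections; simpl; ring. }
    apply G. intros t Ht. apply (s_den_real_imag ka kb t p q); lra || trivial.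
  - destruct (roots_real ka kb HD) as [Rp Rm].
    set (r := sqrt (4 * ka + kb ^ 2)) in *.
    assert (Hr : 0 <= r) by apply sqrt_pos.
    assert (Hr2 : r * r = 4 * ka + kb ^ 2) by now apply sqrt_sqrt.
    destruct (Rlt_or_le kb 0) as [Hb|Hb].
    + assert (Hrk : r < - kb) by nra.
      rewrite Csqrt_nonpos in Rp, Rm by lra.
      split; [|apply blowup_bound_infinite; now rewrite Rp, Rm].
      set (x := sqrt (- ((kb + r) / 2))) in *. set (y := sqrt (- ((kb - r) / 2))) in *.
      assert (Hx : 0 < x) by (apply sqrt_lt_R0; lra).
      assert (Hxy : x <= y) by (apply sqrt_le_1_alt; lra).
      destruct (theta_of_roots ka kb (0, - ((y - x) / 2)) (0, (x + y) / 2)) as [T1 T2].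
      { rewrite Rp. apply injective_projections; simpl; field. }
      { rewrite Rm. apply injective_projections; simpl; field. }
      apply G. intros t Ht. apply (s_den_imag ka kb t ((y - x) / 2) ((x + y) / 2)); lra || trivial.
    + assert (Hr0 : r = 0) by (destruct Hc; nra).
      assert (Hb' : 0 < kb) by nra.
      rewrite Hr0, Rplus_0_r in Rp. rewrite Hr0, Rminus_0_r in Rm.
      split; [|apply blowup_bound_infinite; now rewrite Rp, Rm].
      rewrite Csqrt_nonneg in Rp, Rm by lra.
      destruct (theta_of_roots ka kb (0, 0) (RtoC (sqrt (kb / 2)))) as [T1 T2].
      { rewrite Rp. apply injective_projections; simpl; ring. }
      { rewrite Rm. apply injective_projections; simpl; ring. }
      apply G. intros t Ht. apply (s_den_real_imag ka kb t (sqrt (kb / 2)) 0); trivial; try lra.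
      apply sqrt_lt_R0. lra.
Qed.

(** Since [ka < 0], the root of the discriminant is below [kb], so x + y > x - y > 0 and the roots
    are distinct positive reals. *)
Lemma theta_real (ka kb : R) : ka < 0 -> 0 < kb -> 0 < 4 * ka + kb ^ 2 ->
  exists p q : R, 0 < p < q /\ theta_minus ka kb = RtoC p /\ theta_plus ka kb = RtoC q.
Proof.
  intros Hk Hb HD. destruct (roots_real ka kb) as [Rp Rm]; [lra|].
  assert (Hr : 0 < sqrt (4 * ka + kb ^ 2)) by now apply sqrt_lt_R0.
  assert (Hr2 := sqrt_sqrt (4 * ka + kb ^ 2) ltac:(lra)).
  set (r := sqrt (4 * ka + kb ^ 2)) in *.
  assert (Hrk : r < kb) by nra.
  rewrite Csqrt_nonneg in Rp, Rm by lra.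
  set (x := sqrt ((kb + r) / 2)) in *. set (y := sqrt ((kb - r) / 2)) in *.
  assert (Hy : 0 < y) by (apply sqrt_lt_R0; lra).
  assert (Hxy : y < x) by (apply sqrt_lt_1_alt; lra).
  exists ((x - y) / 2), ((x + y) / 2). split; [lra|].
  apply theta_of_roots.
  - rewrite Rp, <- RtoC_plus. f_equal. field.
  - rewrite Rm, <- RtoC_minus. f_equal. field.
Qed.

(** Since [ka > 0], the root of the discriminant exceeds |kb|, so x + y > 0 > x - y: one root is
    real, the other imaginary, and half their sum and half their difference are conjugate. *)
Lemma theta_conj (ka kb : R) : 0 < ka ->
  exists p q : R, 0 < p /\ 0 < q /\
    theta_minus ka kb = (p, - q) /\ theta_plus ka kb = (p, q).
Proof.
  intros Hk. assert (Hb2 := pow2_ge_0 kb).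
  destruct (roots_real ka kb) as [Rp Rm]; [lra|].
  assert (Hr : 0 < sqrt (4 * ka + kb ^ 2)) by (apply sqrt_lt_R0; lra).
  assert (Hr2 := sqrt_sqrt (4 * ka + kb ^ 2) ltac:(lra)).
  set (r := sqrt (4 * ka + kb ^ 2)) in *.
  assert (Hrk : - r < kb < r) by nra.
  rewrite Csqrt_nonneg in Rp by lra. rewrite Csqrt_nonpos in Rm by lra.
  exists (sqrt ((kb + r) / 2) / 2), (sqrt (- ((kb - r) / 2)) / 2).
  assert (0 < sqrt ((kb + r) / 2)) by (apply sqrt_lt_R0; lra).
  assert (0 < sqrt (- ((kb - r) / 2))) by (apply sqrt_lt_R0; lra).
  split; [lra|]. split; [lra|]. apply theta_of_roots.
  - rewrite Rp. apply injective_projections; simpl; field.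
  - rewrite Rm. apply injective_projections; simpl; field.
Qed.

Lemma blowup_ka_0_pos (kb : R) : 0 < kb ->
  blowup_time 0 kb = Finite (2 * PI / sqrt kb) /\
  blowup_bound 0 kb = Finite (2 * PI / sqrt kb).
Proof.
  intros Hb. assert (HPI := PI_RGT_0). assert (Hs := sqrt_lt_R0 kb Hb).
  assert (Ht : 0 < 2 * PI / sqrt kb) by (apply Rdiv_lt_0_compat; lra).
  split.
  - apply Rbar_le_antisym.
    + apply blowup_le; trivial. now apply no_limit_at_bound.
    + apply blowup_ge; [lra|]. intros t Ht'. now apply limit_pos.
  - assert (Hb2 := pow2_ge_0 kb).
    destruct (roots_real 0 kb) as [Rp Rm]; [lra|].
    replace (4 * 0 + kb ^ 2) with (kb * kb) in Rp, Rm by ring.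
    rewrite sqrt_square in Rp, Rm by lra.
    replace ((kb + kb) / 2) with kb in Rp by field.
    replace ((kb - kb) / 2) with 0 in Rm by field.
    rewrite Csqrt_nonneg in Rp, Rm by lra. rewrite sqrt_0 in Rm.
    rewrite (blowup_bound_eq 0 kb (sqrt kb)).
    + destruct (Req_EM_T (sqrt kb) 0); [lra|trivial].
    + rewrite Rp, Rm. simpl. ring.
Qed.

Lemma blowup_ka_0_nonpos (kb : R) : kb <= 0 ->
  blowup_time 0 kb = p_infty /\ blowup_bound 0 kb = p_infty.
Proof.
  intros Hb. split.
  - apply blowup_infinite. intros t Ht. destruct Hb as [Hb | ->].
    + now apply limit_neg.
    + now apply limit_zero.
  - apply blowup_bound_infinite. assert (Hb2 := pow2_ge_0 kb).
    destruct (roots_real 0 kb) as [-> ->]; [lra|].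
    replace (4 * 0 + kb ^ 2) with ((- kb) * (- kb)) by ring.
    rewrite sqrt_square by lra.
    rewrite !Csqrt_nonpos by lra. reflexivity.
Qed.

(** Equality is characterised for a finite bound, because [ka < 0] with [kb < 0] makes both sides
    infinite. With a finite bound and [ka < 0], equality also occurs when [theta_plus] is an integer
    multiple, at least twice, of [theta_minus]. *)
Theorem proposition1 (ka kb : R) :
  Rbar_le (blowup_time ka kb) (blowup_bound ka kb) /\
  (is_finite (blowup_bound ka kb) ->
     (blowup_time ka kb = blowup_bound ka kb <->
        ka = 0 \/
        exists n : nat, (2 <= n)%nat /\
          theta_plus ka kb = (INR n * theta_minus ka kb)%C)) /\
  (ka = 0 ->
     blowup_time ka kb = blowup_bound ka kb /\
     (0 < kb -> blowup_time ka kb = Finite (2 * PI / sqrt kb)) /\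
     (kb <= 0 -> blowup_time ka kb = p_infty)) /\
  (is_finite (blowup_time ka kb) <->
     (kb >= 0 /\ kb ^ 2 + 4 * ka > 0) \/ (kb < 0 /\ ka > 0)).
Proof.
  assert (Hb2 := pow2_ge_0 kb).
  (* The blow-up time is at least 0, so a real upper bound makes it finite. *)
  assert (Fin : forall T : R, Rbar_le (blowup_time ka kb) T -> is_finite (blowup_time ka kb)).
  { intros T HT. assert (H0 := blowup_ge ka kb 0 (Rle_refl 0)).
    specialize (H0 ltac:(intros; lra)).
    destruct (blowup_time ka kb); simpl in *; easy. }
  destruct (Rtotal_order ka 0) as [Hk | [-> | Hk]].
  - destruct (Rle_or_lt (4 * ka + kb ^ 2) 0) as [HD|HD];
      [|destruct (Rtotal_order kb 0) as [Hb | [Hb | Hb]]; [| subst kb; lra |]].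
    1, 2: destruct (blowup_ka_neg_infinite ka kb Hk) as [-> ->]; [tauto|];
      split; [exact I|]; split; [intros H; discriminate H|];
      split; [lra|]; split; [intros H; discriminate H|lra].
    destruct (theta_real ka kb Hk Hb HD) as [p [q [Hpq [Tm Tp]]]].
    rewrite (blowup_bound_theta ka kb p) by (rewrite ?Tm; trivial; lra).
    destruct (blowup_real ka kb p q) as [B1 B2]; trivial; [lra|].
    split; trivial. split.
    { intros _. rewrite B2. split; [tauto|]. intros [H|H]; [lra|trivial]. }
    split; [lra|]. split; [lra|]. intros _. now apply (Fin (PI / p)).
  - destruct (Rlt_or_le 0 kb) as [Hb|Hb].
    + destruct (blowup_ka_0_pos kb Hb) as [-> ->].
      split; [apply Rbar_le_refl|]. split; [split; auto|].
      split; [intros _; repeat split; trivial; lra|].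
      assert (0 < kb ^ 2) by now apply pow_lt.
      split; [lra|]. intros _. reflexivity.
    + destruct (blowup_ka_0_nonpos kb Hb) as [-> ->].
      split; [exact I|]. split; [split; auto|].
      split; [intros _; repeat split; trivial; lra|].
      split; [intros H; discriminate H|].
      intros [[H1 H2]|H]; [|lra]. assert (kb = 0) by lra. subst kb. lra.
  - destruct (theta_conj ka kb Hk) as [p [q [Hp [Hq [Tm Tp]]]]].
    rewrite (blowup_bound_theta ka kb p) by (rewrite ?Tm; trivial).
    destruct (blowup_conj ka kb p q) as [c [Hc B]]; trivial; [lra|].
    assert (B' : Rbar_le (blowup_time ka kb) (PI / p)).
    { eapply Rbar_le_trans; [exact B|]. simpl. lra. }
    split; trivial. split.
    { intros _. split.
      - intros E. rewrite E in B. simpl in B. lra.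
      (* Imaginary parts of conjugate thetas would satisfy q = - n q, impossible for q > 0. *)
      - intros [H | [n [Hn H]]]; [lra|exfalso].
        rewrite Tm, Tp in H.
        assert (H1 := f_equal fst H). assert (H2 := f_equal snd H). simpl in H1, H2.
        assert (0 <= INR n) by apply pos_INR. nra. }
    split; [lra|]. split; [|intros _; now apply (Fin c)].
    intros _. destruct (Rlt_or_le kb 0); [right|left]; lra.
Qed.
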